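(* Let $\Omega\subset\mathbb{R}^n$ be a (possibly unbounded) domain of class $C^{2+\alpha}$. Let $q\in(1,\infty)$ and $p\ge 1+\frac{2q}{n}$. There exist $\varepsilon_0=\varepsilon_0(n,p,q)>0$ and $C_0=C_0(n,p,q)>0$ with the following property. For any $u_0\in L^\infty(\Omega)\cap M^{q,2q/(p-1)}(\Omega)$, if $$\|u_0\|_{M^{q,2q/(p-1)}(\Omega)}\le\varepsilon_0,$$ then the corresponding maximal classical solution $u$ of $$u_t-\Delta u=|u|^{p-1}u\ \text{ in }\Omega\times(0,\infty),\qquad u=0\ \text{ on }\partial\Omega\times(0,\infty),\qquad u(\cdot,0)=u_0\ \text{ in }\Omega$$ is global and satisfies $$\sup_{t>0}t^{\frac{1}{p-1}}\|u(t)\|_\infty\le C_0\|u_0\|_{M^{q,2q/(p-1)}(\Omega)}.$$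
   Context: $\alpha\in(0,1)$ is some Hölder exponent; $\Omega=\mathbb{R}^n$ is allowed (then the boundary condition is void). For $p>1$ and $u_0\in L^\infty(\Omega)$, the problem $u_t-\Delta u=|u|^{p-1}u$ for $x\in\Omega$, $t>0$, with $u=0$ for $x\in\partial\Omega$, $t>0$, and $u(\cdot,0)=u_0$ in $\Omega$, admits a unique maximal classical solution $u$, with maximal existence time $T_{max}\in(0,\infty]$; it is bounded on $\Omega\times[0,T']$ for each $T'<T_{max}$ and satisfies $u(t)=e^{-tA}u_0+\int_0^te^{-(t-s)A}(|u|^{p-1}u)(s)\,ds$, where $e^{-tA}$ is the Dirichlet heat semigroup on $L^\infty(\Omega)$. If $T_{max}<\infty$ then $\lim_{t\to T_{max}}\|u(t)\|_\infty=\infty$. The solution is called global if $T_{max}=\infty$. Morrey space: for $q\in[1,\infty)$ and $\lambda\in[0,n]$, $M^{q,\lambda}(\Omega)=\{f\in L^q_{loc}(\Omega):\ \|f\|_{M^{q,\lambda}(\Omega)}<\infty\}$, where $$\|f\|_{M^{q,\lambda}(\Omega)}^q=\sup_{a\in\Omega}\ \sup_{R>0}R^{\lambda-n}\int_{B_R(a)\cap\Omega}|f|^q\,dx.$$ *)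

(* Defs.v *)
(* Points of R^n are row
   vectors 'rV[R]_n over a realType; the library's norm on them is the maximum norm, so the
   Euclidean norm and balls are defined below. *)
From HB Require Import structures.
From mathcomp Require Import all_boot all_order all_algebra.
From mathcomp Require Import all_classical all_reals all_analysis.

Set Implicit Arguments.
Unset Strict Implicit.
Unset Printing Implicit Defensive.

Import Order.TTheory GRing.Theory Num.Theory.
Import numFieldNormedType.Exports.

Local Open Scope classical_set_scope.
Local Open Scope ring_scope.

(* The Borel sigma-algebra of R^n, generated by the coordinates (as the library
   does for n.-tuple).  A Lebesgue measurable function has a Borel measurable
   representative, so spaces of classes of functions lose nothing. *)
Section measurable_rV.
Context {R : realType}.
Variable n : nat.

Let coors : 'I_n -> 'rV[R]_n -> measurableTypeR R := fun i x => x 0 i.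

Let rV_set0 : g_sigma_preimage coors set0.
Proof. exact: sigma_algebra0. Qed.

Let rV_setC A : g_sigma_preimage coors A -> g_sigma_preimage coors (~` A).
Proof. exact: sigma_algebraC. Qed.

Let rV_bigcup (F : _^nat) : (forall i, g_sigma_preimage coors (F i)) ->
  g_sigma_preimage coors (\bigcup_i (F i)).
Proof. exact: sigma_algebra_bigcup. Qed.

Definition rV_display : measure_display.
Proof. exact: default_measure_display. Qed.

HB.instance Definition _ := @isMeasurable.Build rV_display
  'rV[R]_n (g_sigma_preimage coors) rV_set0 rV_setC rV_bigcup.
End measurable_rV.



(* Lebesgue measure on R^n, by recursion: the product of the Lebesgue measure on
   R and of that on R^n, carried to R^(n+1).  The product measure of two
   sigma-finite measures has no usable canonical sigma-finite instance in the
   library, hence step_sigma_finite. *)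
Section lebesgue_rV.
Context {R : realType}.
Local Notation mR := (measurableTypeR R).

Definition rV_cons n (z : mR * 'rV[R]_n) : 'rV[R]_n.+1 :=
  \row_j if unlift ord0 j is Some k then z.2 0 k else z.1.

Definition rV_uncons n (x : 'rV[R]_n.+1) : mR * 'rV[R]_n :=
  (x 0 ord0, \row_j x 0 (lift ord0 j)).

Lemma rV_consK n : cancel (@rV_cons n) (@rV_uncons n).
Proof.
move=> [a y]; rewrite /rV_uncons /rV_cons; congr pair => /=.
  by rewrite mxE unlift_none.
by apply/rowP => j; rewrite !mxE liftK.
Qed.

Lemma measurable_coord n (i : 'I_n) :
  measurable_fun [set: 'rV[R]_n] (fun x => x 0 i : mR).
Proof.
move=> _ Y mY; rewrite setTI; apply: sub_sigma_algebra => /=.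
rewrite -bigcup_seq/=; exists i => /=; first by rewrite mem_index_enum.
by exists Y => //; rewrite setTI.
Qed.

Lemma measurable_fun_rVP d (T : measurableType d) n (f : T -> 'rV[R]_n) :
  (forall i, measurable_fun [set: T] (fun t => f t 0 i : mR)) ->
  measurable_fun [set: T] f.
Proof.
move=> mf _ A mA; rewrite setTI.
suff: preimage_set_system [set: T] f
    (@measurable _ 'rV[R]_n) `<=` measurable.
  by apply; exists A => //; rewrite setTI.
rewrite /measurable /= -g_sigma_preimage_comp.
apply: smallest_sub; first exact: sigma_algebra_measurable.
rewrite -bigcup_seq; apply: bigcup_sub => i _ B [C mC <-].
exact: mf.
Qed.

Lemma measurable_rV_cons n : measurable_fun [set: _] (@rV_cons n).
Proof.
apply: measurable_fun_rVP => i; under eq_fun do rewrite mxE.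
case: unliftP => [k|] _; last exact: measurable_fst.
exact: (measurableT_comp (measurable_coord k) measurable_snd).
Qed.

Lemma measurable_rV_uncons n : measurable_fun [set: _] (@rV_uncons n).
Proof.
apply: measurable_fun_pair => /=; first exact: measurable_coord.
apply: measurable_fun_rVP => i.
under eq_fun do rewrite mxE.
exact: measurable_coord.
Qed.

Section step.
Variables (n : nat) (m : {sigma_finite_measure set 'rV[R]_n -> \bar R}).

Definition lebesgue_rV_step : set 'rV[R]_n.+1 -> \bar R :=
  pushforward (@lebesgue_measure R \x m)%E (@rV_cons n).

Let step0 : lebesgue_rV_step set0 = 0%E.
Proof. by rewrite /lebesgue_rV_step /pushforward preimage_set0 measure0. Qed.

Let step_ge0 A : (0 <= lebesgue_rV_step A)%E.
Proof. by rewrite /lebesgue_rV_step /pushforward measure_ge0. Qed.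

Let step_sigma_additive : semi_sigma_additive lebesgue_rV_step.
Proof.
move=> F mF tF mUF; rewrite /lebesgue_rV_step /pushforward preimage_bigcup.
apply: measure_semi_sigma_additive.
- by move=> k; rewrite -[X in measurable X]setTI; exact: measurable_rV_cons.
- apply/trivIsetP => /= i j _ _ ij; rewrite -preimage_setI.
  by move/trivIsetP : tF => /(_ _ _ _ _ ij) ->//; rewrite preimage_set0.
- rewrite -preimage_bigcup -[X in measurable X]setTI.
  exact: measurable_rV_cons.
Qed.

HB.instance Definition _ := isMeasure.Build _ _ _
  lebesgue_rV_step step0 step_ge0 step_sigma_additive.

Let step_sigma_finite : sigma_finite setT lebesgue_rV_step.
Proof.
have /sigma_finiteP[F [TF ndF Foo]] := sigma_finiteT (@lebesgue_measure R).
have /sigma_finiteP[G [TG ndG Goo]] := sigma_finiteT m.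
exists (fun k => @rV_uncons n @^-1` (F k `*` G k)).
  rewrite -preimage_bigcup (_ : \bigcup_k (F k `*` G k) = setT) ?preimage_setT//.
  apply/seteqP; split => // -[x y] _.
  have [i _ Fix] : (\bigcup_i F i) x by rewrite -TF.
  have [j _ Gjy] : (\bigcup_j G j) y by rewrite -TG.
  exists (maxn i j) => //; split.
  - by move: x Fix; exact/subsetPset/ndF/leq_maxl.
  - by move: y Gjy; exact/subsetPset/ndG/leq_maxr.
move=> k; have [mF Fk] := Foo k; have [mG Gk] := Goo k; split.
  rewrite -[X in measurable X]setTI; apply: measurable_rV_uncons => //.
  exact: measurableX.
rewrite /lebesgue_rV_step /pushforward -comp_preimage.
rewrite (_ : _ \o _ = id); last by apply/funext => z; exact: rV_consK.
rewrite preimage_id product_measure1E//.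
by rewrite lte_mul_pinfty// ge0_fin_numE.
Qed.

HB.instance Definition _ := Measure_isSigmaFinite.Build _ _ _
  lebesgue_rV_step step_sigma_finite.

End step.

Fixpoint lebesgue_rV n : {sigma_finite_measure set 'rV[R]_n -> \bar R} :=
  match n with
  | 0 => [the {sigma_finite_measure set 'rV[R]_0 -> \bar R}
             of \d_(0 : 'rV[R]_0)]
  | n'.+1 => [the {sigma_finite_measure set 'rV[R]_n'.+1 -> \bar R}
                of lebesgue_rV_step (lebesgue_rV n')]
  end.
End lebesgue_rV.

Section euclidean.
Context {R : realType} {n : nat}.
Implicit Types (x a : 'rV[R]_n) (f : 'rV[R]_n -> R) (Omega : set 'rV[R]_n).

Definition enorm x : R := Num.sqrt (\sum_i x 0 i ^+ 2).

Definition eball a (r : R) : set 'rV[R]_n := [set x | enorm (x - a) < r].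

Definition boundary Omega : set 'rV[R]_n := closure Omega `\` interior Omega.

Definition partial (i : 'I_n) f : 'rV[R]_n -> R :=
  fun x => 'D_(delta_mx 0 i) f x.

Definition laplacian f x : R := \sum_i partial i (partial i f) x.

(* Second partial derivatives that are locally Hoelder are continuous. *)
Definition C2alpha (alpha : R) f : Prop :=
  [/\ continuous f,
      forall i x, derivable f x (delta_mx 0 i),
      forall i, continuous (partial i f),
      forall i j x, derivable (partial i f) x (delta_mx 0 j) &
      forall i j (r : R), exists L : R, forall x y,
        enorm x <= r -> enorm y <= r ->
        `|partial j (partial i f) x - partial j (partial i f) y|
          <= L * enorm (x - y) `^ alpha].

End euclidean.

(* Near each boundary point and for some coordinate i, Omega is the part strictly
   above (s = false) or below (s = true) the graph of a C^{2+alpha} function of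
   the other coordinates.  Neither boundedness nor uniformity in the boundary
   point is required; the last clause is void if Omega = R^n. *)
Definition C2alpha_domain {R : realType} {n : nat} (alpha : R)
    (Omega : set 'rV[R]_n) : Prop :=
  [/\ open Omega, connected Omega, Omega !=set0 &
    forall x, boundary Omega x ->
      exists (r : R) (i : 'I_n) (s : bool) (g : 'rV[R]_n.-1 -> R),
        [/\ 0 < r, C2alpha alpha g &
          eball x r `&` Omega =
          eball x r `&`
            [set y : 'rV[R]_n | 0 < (-1) ^+ s * (y 0 i - g (col' i y))]]].

Section spaces.
Context {R : realType} {n : nat}.
Local Notation mu := (@lebesgue_rV R n).
Implicit Types (Omega : set 'rV[R]_n) (f : 'rV[R]_n -> R).

Definition Linfty_norm Omega f : \bar R :=
  'N[mu]_(+oo%E)[(EFin \o f) \_ Omega].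

Definition Linfty Omega f : Prop :=
  measurable_fun Omega f /\ (Linfty_norm Omega f < +oo)%E.

Definition Lloc Omega (q : R) f : Prop :=
  measurable_fun Omega f /\
  forall K, compact K -> K `<=` Omega ->
    (\int[mu]_(x in K) (`|f x| `^ q)%:E < +oo)%E.

Definition morrey_norm Omega (q lambda : R) f : \bar R :=
  (ereal_sup [set y | exists (a : 'rV[R]_n) (r : R),
     [/\ Omega a, (0 < r)%R &
         y = (r `^ (lambda - n%:R))%:E *
             \int[mu]_(x in eball a r `&` Omega) (`|f x| `^ q)%:E]] `^ q^-1)%E.

Definition morrey Omega (q lambda : R) f : Prop :=
  Lloc Omega q f /\ (morrey_norm Omega q lambda f < +oo)%E.

End spaces.

(* Functions of (t, x) are curried, time first.  Values of u at t <= 0 or outside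
   the closure of Omega are irrelevant. *)
Section parabolic.
Context {R : realType} {n : nat}.
Local Notation mu := (@lebesgue_rV R n).
Implicit Types (Omega : set 'rV[R]_n) (f : 'rV[R]_n -> R)
  (u w h : R -> 'rV[R]_n -> R) (T : \bar R).

Definition cylinder Omega T : set (R * 'rV[R]_n) :=
  [set z | [/\ 0 < z.1, (z.1%:E < T)%E & Omega z.2]].

Definition C21 (Q : set (R * 'rV[R]_n)) u : Prop :=
  let cont v := forall z, Q z -> {for z, continuous (fun z => v z.1 z.2)} in
  [/\ cont u,
      (forall t x, Q (t, x) -> derivable (u^~ x) t 1) /\
        cont (fun t x => derive1 (u^~ x) t),
      forall i, (forall t x, Q (t, x) -> derivable (u t) x (delta_mx 0 i)) /\
        cont (fun t => partial i (u t)) &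
      forall i j,
        (forall t x, Q (t, x) -> derivable (partial i (u t)) x (delta_mx 0 j)) /\
        cont (fun t => partial j (partial i (u t)))].

(* u_t - Delta u = h classically in Omega x (0, T), u = 0 on the lateral
   boundary. *)
Definition dirichlet_solution Omega T h u : Prop :=
  [/\ C21 (cylinder Omega T) u,
      {within cylinder (closure Omega) T, continuous (fun z => u z.1 z.2)},
      forall t x, cylinder Omega T (t, x) ->
        derive1 (u^~ x) t - laplacian (u t) x = h t x &
      forall t x, cylinder (boundary Omega) T (t, x) -> u t x = 0].

(* The bounded classical solution w of the heat equation in Omega x (0, oo) with
   homogeneous Dirichlet condition and initial value f in L^oo(Omega).  For
   f in L^oo one cannot ask for convergence in L^oo as t -> 0+; the initial value
   is attained in L^1 on bounded parts of Omega.  By the maximum principle, w is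
   unique on Omega. *)
Definition heat_flow Omega f w : Prop :=
  [/\ dirichlet_solution Omega +oo (fun _ _ => 0) w,
      exists M : R, forall t x, 0 < t -> Omega x -> `|w t x| <= M &
      forall r : R, 0 < r ->
        (\int[mu]_(x in eball 0 r `&` Omega) `|w t x - f x|%:E)%E
          @[t --> 0^'+] --> 0%E].

(* The Dirichlet heat semigroup e^{-tA} on L^oo(Omega), for t > 0. *)
Definition heat_semigroup Omega (t : R) f : 'rV[R]_n -> R :=
  xget (fun _ _ => 0) (heat_flow Omega f) t.

Definition power_nonlinearity (p y : R) : R := `|y| `^ (p - 1) * y.

(* As usual for data in L^oo, the initial condition u(0) = u0 means
   that u(t) - e^{-tA} u0 tends to 0 in L^oo(Omega) as t -> 0+. *)
Definition classical_solution Omega (p : R) f T u : Prop :=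
  [/\ (0 < T)%E,
      dirichlet_solution Omega T (fun t x => power_nonlinearity p (u t x)) u,
      forall T' : R, (T'%:E < T)%E ->
        exists M : R, forall t x, 0 < t <= T' -> Omega x -> `|u t x| <= M &
      Linfty_norm Omega (fun x => u t x - heat_semigroup Omega t f x)
        @[t --> 0^'+] --> 0%E].

(* The maximal classical solution u with its maximal existence time T: it has
   no proper extension, and it comes with the variation-of-constants formula and
   the blow-up alternative given by the local theory for data in L^oo. *)
Record maximal_classical_solution Omega (p : R) f T u : Prop := {
  maximal_classical : classical_solution Omega p f T u ;
  maximal_no_extension : forall T' v, classical_solution Omega p f T' v ->
    (T <= T')%E ->
    (forall t x, cylinder Omega T (t, x) -> v t x = u t x) ->
    T' = T ;
  maximal_duhamel : forall t x, cylinder Omega T (t, x) ->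
    u t x = heat_semigroup Omega t f x +
      \int[@lebesgue_measure R]_(s in `]0, t[)
        heat_semigroup Omega (t - s)
          (fun y => power_nonlinearity p (u s y)) x ;
  maximal_blowup : forall T0 : R, T = T0%:E ->
    Linfty_norm Omega (u t) @[t --> T0^'-] --> +oo%E
}.

End parabolic.

(* Main.v *)
(* Let g = |u0|^q on Omega (truncated at a bound of the heat flow of u0) and let
   phi be its Gaussian potential, a solution of the heat equation on the whole
   space. A decomposition into dyadic shells gives
   phi(t) <= K ||u0||^q t^(-q/(p-1)) on Omega, where ||.|| is the Morrey norm.
   With sg = min(1, p/q) and gam = (sg q - 1)/(p - 1) > 0, this bound makes
   phi^(1/q) + B t^gam phi^sg, for a suitable B, a classical supersolution which is
   at most 2 phi^(1/q) as soon as ||u0|| is small: the powers phi^(1/q) and phi^sg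
   are supersolutions of the heat equation by concavity, and the derivative of
   t^gam absorbs the source term. The Dirichlet heat flow of u0 is dominated by
   phi^(1/q), by comparison with the affine functions of phi tangent to this
   power, so that u lies below the supersolution as t -> 0, up to a uniformly
   small error. The maximum principle propagates this, hence
   |u| <= 2 phi^(1/q) <= C0 ||u0|| t^(-1/(p-1)), which also rules out blow-up. *)

(* Three obstacles shape the argument. The data are attained only in L^1 on bounded sets, and
   [heat_semigroup] is given without a kernel. Jensen's inequality, which would yield |e^{-tA} u0|
   <= phi^(1/q), is therefore replaced by comparison with all functions a phi + b such that y <= a
   y^q + b for y >= 0. The comparison starts at a time tau > 0, when the flow is continuous up to
   the boundary, and tau then tends to 0 inside the Gaussian potential, where L^1 convergence is
   enough. Next, phi may vanish, and the concave powers have no tangent at 0: a constant eta > 0 is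
   added to phi. It is del times t^(-q/(p-1)) at the final time t, so that it obeys the same decay
   as phi, and del tends to 0 at the end. Finally, Omega may be unbounded and solutions are merely
   bounded: the maximum principle penalises by 1 + |x|^2, and its differential inequality is asked
   of test functions touching from below. *)
Require Import Defs.
From mathcomp Require Import all_boot all_order all_algebra.
From mathcomp Require Import all_classical all_reals all_analysis.
From mathcomp Require Import measurable_realfun ess_sup_inf.
From mathcomp Require Import ring lra.

Set Implicit Arguments.
Unset Strict Implicit.
Unset Printing Implicit Defensive.

Import Order.TTheory GRing.Theory Num.Theory.
Import numFieldNormedType.Exports.

Local Open Scope classical_set_scope.
Local Open Scope ring_scope.

(** * One-dimensional calculus *)

Section calculus.
Context {R : realType}.
Implicit Types f g : R -> R.

(** A derivative of f is asked near 0, and one of f' at 0 only. This suffices for the second-order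
    condition at a maximum, and it is what the restriction of a function to a coordinate line
    through one point provides. *)
Definition second_derive f (D : R) :=
  exists f', (\forall s \near (0 : R), is_derive s (1 : R) f (f' s)) /\
             is_derive (0 : R) (1 : R) f' D.

Lemma second_derive_linear f g (a b : R) (Df Dg : R) :
  second_derive f Df -> second_derive g Dg ->
  second_derive (fun s => a * f s + b * g s) (a * Df + b * Dg).
Proof.
move=> [f' [nf Hf]] [g' [ng Hg]].
exists (fun s => a * f' s + b * g' s); split; last exact: is_deriveD.
near=> s.
have ? : is_derive s (1 : R) f (f' s) by near: s.
have ? : is_derive s (1 : R) g (g' s) by near: s.
exact: is_deriveD.
Unshelve. all: by end_near. Qed.

Lemma second_derive_cst (c : R) : second_derive (cst c) 0.
Proof. by exists (cst 0); split; [near=> s|]; exact: is_derive_cst.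
Unshelve. all: by end_near. Qed.

Lemma second_derive_id : second_derive (@idfun R) 0.
Proof.
by exists (cst 1); split; [near=> s; exact: is_derive_id|exact: is_derive_cst].
Unshelve. all: by end_near. Qed.

Lemma second_derive_sqr : second_derive (fun s => s ^+ 2) 2.
Proof.
exists (fun s => 2 * s); split.
  near=> s; apply: is_derive_eq (is_deriveX 2 (is_derive_id s (1 : R))) _.
  by rewrite expr1 scaler1.
apply: is_derive_eq (is_deriveZ 2 (is_derive_id (0 : R) (1 : R))) _.
by rewrite scaler1.
Unshelve. all: by end_near. Qed.

Lemma second_derive_eq f g (D D' : R) : f =1 g -> D = D' ->
  second_derive f D -> second_derive g D'.
Proof. by move=> /funext -> ->. Qed.

(** If D > 0, Fermat's rule gives f' 0 = 0, hence f' h > 0 for small h > 0, and the mean value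
    theorem on [0, s] makes f s exceed f 0. *)
Lemma second_derive_max f (D : R) : second_derive f D ->
  (\forall s \near (0 : R), f s <= f 0) -> D <= 0.
Proof.
move=> [f' [nf [f'd f'D]]] fmax; rewrite leNgt; apply/negP => D0.
have /nbhs_ballP[e /= e0 He] : \forall s \near (0 : R),
    is_derive s (1 : R) f (f' s) /\ f s <= f 0.
  by near=> s; split; near: s.
have He' s : `|s| < e -> is_derive s (1 : R) f (f' s) /\ f s <= f 0.
  by move=> se; apply: He; rewrite /ball /= sub0r normrN.
have f'0 : f' 0 = 0.
  have [|fd0 fv0] := He' 0; first by rewrite normr0.
  have -> : f' 0 = 'D_1 f 0 by case: fd0.
  suff [] : is_derive (0 : R) (1 : R) f 0 by [].
  apply: (@derive1_at_max R f (- e) e 0).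
  - by rewrite ge0_cp// ltW.
  - move=> t; rewrite in_itv/= => te; have [|[]//] := He' t.
    by rewrite ltr_norml.
  - by rewrite in_itv/= oppr_lt0 e0.
  - move=> t; rewrite in_itv/= => te; have [|] := He' t => //.
    by rewrite ltr_norml.
have [d /= d0 Hd] : \forall h \near (0 : R)^', 0 < h^-1 * f' h.
  have : h^-1 *: (f' (h *: 1 + 0) - f' 0) @[h --> (0 : R)^'] --> D.
    by rewrite -f'D; exact: f'd.
  move=> /cvgr_gt /(_ _ D0); apply: filterS => h.
  by rewrite f'0 subr0 addr0 /GRing.scale /= mulr1.
pose s := (Num.min e d) / 2.
have med : 0 < Num.min e d by rewrite lt_min e0.
have s0 : 0 < s by rewrite divr_gt0.
have sm : s < Num.min e d by rewrite ltr_pdivrMr// mulr_natr mulr2n ltrDl.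
have := sm; rewrite lt_min => /andP[se sd].
have [||c] := @MVT R f f' 0 s s0.
- move=> x; rewrite in_itv/= => /andP[x0 xs]; have [|//] := He' x.
  by rewrite gtr0_norm// (lt_trans xs).
- apply: derivable_within_continuous => x; rewrite in_itv/= => /andP[x0 xs].
  have [|[]//] := He' x; by rewrite ger0_norm// (le_lt_trans xs).
rewrite in_itv/= => /andP[c0 cs] Ef.
have [] := He' s; first by rewrite gtr0_norm.
move=> _; rewrite -subr_le0 Ef subr0 leNgt => /negP; apply.
rewrite mulr_gt0//.
have := Hd c; rewrite /ball /= sub0r normrN gtr0_norm// (lt_trans cs)//.
move=> /(_ erefl); rewrite gt_eqF// => /(_ erefl).
by rewrite pmulr_rgt0// invr_gt0.
Unshelve. all: by end_near. Qed.

(* One-sided version: [t] may be the right end point of the time interval. *)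
Lemma derive_max_left f (t a d : R) : a < t -> is_derive t (1 : R) f d ->
  (forall s, a < s <= t -> f s <= f t) -> 0 <= d.
Proof.
move=> at_ [fd fD] fmax.
have cf : h^-1 *: (f (h *: 1 + t) - f t) @[h --> (0 : R)^'-] --> d.
  rewrite -fD => A /fd /nbhs_ballP[e e0 He].
  by exists e => //= y ye /lt_eqF/negbT; exact: He.
rewrite -(cvg_lim _ cf)//; apply: limr_ge; first by apply/cvg_ex; exists d.
near=> h.
have h0 : h < 0 by near: h; exact: nbhs_left_lt.
have ht : a - t < h by near: h; apply: nbhs_left_gt; rewrite subr_lt0.
rewrite /GRing.scale/= mulr1 mulr_le0//; first by rewrite invr_le0 ltW.
rewrite subr_le0; apply: fmax.
by rewrite -ltrBlDr ht/= -lerBrDr subrr ltW.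
Unshelve. all: by end_near. Qed.

End calculus.

Section sqn.
Context {R : realType} {n : nat}.
Implicit Types x y : 'rV[R]_n.

Definition sqn x : R := \sum_i x 0 i ^+ 2.

Lemma sqn_ge0 x : 0 <= sqn x.
Proof. by apply: sumr_ge0 => i _; exact: sqr_ge0. Qed.

Lemma enormE x : enorm x = Num.sqrt (sqn x). Proof. by []. Qed.

Lemma sqn_enorm x : sqn x = enorm x ^+ 2.
Proof. by rewrite enormE sqr_sqrtr// sqn_ge0. Qed.

Lemma enorm_lt x (r : R) : 0 < r -> (enorm x < r) = (sqn x < r ^+ 2).
Proof.
by move=> r0; rewrite sqn_enorm ltr_pXn2r ?nnegrE ?sqrtr_ge0 ?(ltW r0).
Qed.

Lemma sqr_coord_le x i : x 0 i ^+ 2 <= sqn x.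
Proof.
rewrite /sqn (bigD1 i)//= lerDl; apply: sumr_ge0 => j _; exact: sqr_ge0.
Qed.

Lemma normr_le_enorm x : `|x| <= enorm x.
Proof.
rewrite [leLHS]mx_normrE; apply/bigmax_leP; split; first exact: sqrtr_ge0.
move=> [i j] _ /=; rewrite ord1 -sqrtr_sqr ler_wsqrtr//.
exact: sqr_coord_le.
Qed.

Lemma sqn_shift x i (s : R) :
  sqn (x + s *: delta_mx 0 i) = sqn x + 2 * x 0 i * s + s ^+ 2.
Proof.
rewrite /sqn (bigD1 i)//= [in RHS](bigD1 i)//= !mxE !eqxx mulr1.
rewrite (eq_bigr (fun j => x 0 j ^+ 2)); first by ring.
by move=> j /negPf ji; rewrite !mxE ji andbF mulr0 addr0.
Qed.

Lemma sqn_continuous : continuous sqn.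
Proof.
move=> x; apply: (@cvg_big _ _ _ _ _ _ _ (nbhs x)) => [|i _].
  by move=> z; apply: cvgD; [exact: cvg_fst|exact: cvg_snd].
by apply: cvgM; exact: coord_continuous.
Qed.

Lemma second_derive_sqn x i :
  second_derive (fun s => sqn (x + s *: delta_mx 0 i)) 2.
Proof.
apply: (@second_derive_eq _ _ _ _ _ _ _ (second_derive_linear 1 1
  (second_derive_linear (sqn x) (2 * x 0 i) (second_derive_cst 1)
    second_derive_id) second_derive_sqr)) => [s|].
  by rewrite sqn_shift /=; ring.
by ring.
Qed.

End sqn.

(** * Maximum principle on an unbounded domain *)

Section within.
Context {R : realType} {T : topologicalType}.
Implicit Types (A : set T) (f g : T -> R).

Lemma within_continuousM A f g : {within A, continuous f} ->
  {within A, continuous g} -> {within A, continuous (fun x => f x * g x)}.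
Proof.
by move=> cf cg x; exact: (@continuousM R (subspace A) f g x (cf x) (cg x)).
Qed.

Lemma within_continuousB A f g : {within A, continuous f} ->
  {within A, continuous g} -> {within A, continuous (fun x => f x - g x)}.
Proof.
by move=> cf cg x; exact: (@continuousB R R (subspace A) f g x (cf x) (cg x)).
Qed.

End within.

Section maximum_principle.
Context {R : realType} {n : nat}.
Implicit Types (x y : 'rV[R]_n) (Omega : set 'rV[R]_n).

Lemma near_line Omega x i : open Omega -> Omega x ->
  \forall s \near (0 : R), Omega (x + s *: delta_mx 0 i).
Proof.
move=> oO Ox.
have cl : {for 0, continuous (fun s : R => x + s *: delta_mx 0 i)}.
  by apply: cvgD; [exact: cvg_cst|apply: cvgZr_tmp; exact: cvg_id].
by apply: cl; rewrite scale0r addr0; exact: open_nbhs_nbhs.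
Qed.

Lemma not_boundary Omega x : open Omega -> closure Omega x ->
  ~ boundary Omega x -> Omega x.
Proof.
move=> oO cO nb; apply: contrapT => nO; apply: nb; split => // /interior_subset.
exact: nO.
Qed.

(** If z were positive somewhere, so would be exp(-L t) z - th (1 + |x|^2) for small th. As z <= M,
    its positivity is confined to a ball, and by the initial condition to times above some tau, so
    it has a positive maximum, attained at a point of Omega. There [zeta] touches z from below and
    inherits the maximum, and its derivatives contradict the choice of L. Asking for [zeta] instead
    of derivatives of z lets concave powers be replaced by tangents. *)
Lemma maximum_principle Omega (T K M : R) (z : R -> 'rV[R]_n -> R) :
  open Omega ->
  {within [set w : R * 'rV[R]_n | 0 < w.1 <= T /\ closure Omega w.2],
    continuous (fun w => z w.1 w.2)} ->
  (forall (t : R) x, 0 < t <= T -> Omega x -> z t x <= M) ->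
  (forall (t : R) x, 0 < t <= T -> boundary Omega x -> z t x <= 0) ->
  (forall x0, closure Omega x0 -> forall e : R, 0 < e ->
    \forall x \near x0 & t \near (0 : R)^'+, Omega x -> z t x <= e) ->
  (forall (t : R) x, 0 < t <= T -> Omega x -> 0 < z t x ->
    exists (zeta : R -> 'rV[R]_n -> R) (d : R) (D : 'I_n -> R),
    [/\ zeta t x = z t x,
        forall (s : R) y, 0 < s <= T -> Omega y -> zeta s y <= z s y,
        is_derive t (1 : R) (zeta^~ x) d,
        forall i, second_derive (fun s => zeta t (x + s *: delta_mx 0 i)) (D i)
        & d - \sum_i D i <= K * z t x]) ->
  forall (t : R) x, 0 < t <= T -> Omega x -> z t x <= 0.
Proof.
move=> oO cz zM zb zi zeq t1 x1 t1T Ox1; rewrite leNgt; apply/negP => z1.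
(* The penalty [th * (1 + sqn x)] has Laplacian 2 n th, and th < E z at the maximum: the term 2 n
   pays for it, and the last 1 makes the contradiction strict. *)
pose L := K + n.*2%:R + 1.
pose E t := expR (- (L * t)).
have E0 t : 0 < E t by exact: expR_gt0.
have s1 x : 0 < 1 + sqn x by rewrite ltr_pwDl// sqn_ge0.
(* Half of the value for which [V] would vanish at (t1, x1). *)
pose th := E t1 * z t1 x1 / (1 + sqn x1) / 2.
have th0 : 0 < th by rewrite !divr_gt0// mulr_gt0.
pose V t x := E t * z t x - th * (1 + sqn x).
have V1 : 0 < V t1 x1.
  rewrite /V /th [X in _ - X]mulrAC divfK ?gt_eqF//.
  by rewrite subr_gt0 ltr_pdivrMr// mulr_natr mulr2n ltrDl mulr_gt0.
pose EM := expR (`|L| * T).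
have EM0 : 0 < EM by exact: expR_gt0.
have EEM t : 0 < t <= T -> E t <= EM.
  move=> /andP[t0 tT]; rewrite ler_expR (le_trans (ler_norm _))// normrN normrM.
  by rewrite ler_wpM2l// gtr0_norm.
have emM : 0 <= EM * `|M| by rewrite mulr_ge0 // ltW.
(* For |x| > rho the penalty exceeds EM |M|, which bounds [E t * z t x]; the added 1 gives rho <=
   rho^2. *)
pose rho := EM * `|M| / th + 1.
have rho1 : 1 <= rho by rewrite lerDr divr_ge0 // ltW.
have Vrho t x : 0 < t <= T -> Omega x -> 0 < V t x -> `|x| <= rho.
  move=> tT Ox Vp; rewrite leNgt; apply/negP => xrho.
  move: Vp; rewrite ltNge => /negP; apply; rewrite subr_le0.
  apply: (@le_trans _ _ (EM * `|M|)).
    apply: (@le_trans _ _ (E t * `|M|)).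
      by rewrite ler_pM2l// (le_trans (zM _ _ tT Ox))// ler_norm.
    by rewrite ler_wpM2r// EEM.
  rewrite -ler_pdivrMl// mulrC (@le_trans _ _ rho)// ?lerDl// (@le_trans _ _ (rho ^+ 2))//.
    by rewrite ler_eXnr.
  rewrite (@le_trans _ _ (sqn x))// ?lerDr// sqn_enorm lerXn2r ?nnegrE//.
  - exact: le_trans rho1.
  - exact: sqrtr_ge0.
  - by rewrite (le_trans (ltW xrho))// normr_le_enorm.
pose C0 := closure Omega `&` [set x | `|x| <= rho].
have cC0 : compact C0.
  apply: bounded_closed_compact.
    exists rho; split; first exact: num_real.
    by move=> r rr x [_ /= xr]; rewrite (le_trans xr)// ltW.
  apply: closedI; first exact: closed_closure.
  exact: (preimage_closed (fun x _ => @norm_continuous _ _ x) (@closed_le _ _)).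
have EMth : 0 < th / EM by rewrite divr_gt0.
(* Compactness turns the initial condition, stated around each point, into a single time range valid
   on all of [C0]. *)
have : \forall t \near (0 : R)^'+, C0 `<=` [set x | Omega x -> z t x <= th / EM].
  have /compact_near_coveringP := cC0; apply => x [cx _].
  exact: zi.
move=> [tau0 /= tau00 Htau0].
pose tau := Num.min (tau0 / 2) t1.
have /andP[t10 t1T'] := t1T.
have tau_gt0 : 0 < tau by rewrite lt_min divr_gt0.
have tau_lt : tau < tau0.
  by rewrite gt_min ltr_pdivrMr// mulr_natr mulr2n ltrDl tau00.
have Vtau t x : 0 < t <= tau -> t <= T -> Omega x -> `|x| <= rho -> V t x <= 0.
  move=> /andP[t0 ttau] tT Ox xr; rewrite subr_le0.
  have zt : z t x <= th / EM.
    apply: (Htau0 t) => //; last by split => //; exact: subset_closure.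
    by rewrite /ball/= sub0r normrN gtr0_norm// (le_lt_trans ttau).
  apply: (@le_trans _ _ (E t * (th / EM))); first by rewrite ler_pM2l.
  rewrite mulrCA ler_pM2l// (@le_trans _ _ 1)// ?lerDl ?sqn_ge0//.
  by rewrite ler_pdivrMr// mul1r EEM// t0.
pose C := `[tau, T]%classic `*` C0.
have cC : compact C by apply: compact_setX => //; exact: segment_compact.
have C0n : C !=set0.
  exists (t1, x1); split => /=; first by rewrite in_itv/= t1T' andbT ge_min lexx orbT.
  by split; [exact: subset_closure|exact: Vrho V1].
have cV : {within C, continuous (fun w => V w.1 w.2)}.
  have cz' : {within C, continuous (fun w => z w.1 w.2)}.
    apply: continuous_subspaceW cz => -[t x] [/= + []].
    by rewrite in_itv/= => /andP[ht ->] ? _; rewrite (lt_le_trans tau_gt0).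
  have cE : continuous (fun w : R * 'rV[R]_n => E w.1).
    move=> w.
    apply: (@continuous_comp _ _ _ (fun w : R * 'rV[R]_n => - (L * w.1)) expR).
      by apply: cvgN; apply: cvgMl_tmp; exact: cvg_fst.
    exact: continuous_expR.
  have cs : continuous (fun w : R * 'rV[R]_n => th * (1 + sqn w.2)).
    move=> w; apply: cvgMl_tmp; apply: cvgD; first exact: cvg_cst.
    by apply: (@continuous_comp _ _ _ snd sqn); [exact: cvg_snd|exact: sqn_continuous].
  apply: within_continuousB; last exact: continuous_subspaceT cs.
  by apply: within_continuousM => //; exact: continuous_subspaceT cE.
have [[ts xs]] := compact_EVT_max C0n cC cV.
rewrite inE => -[/=]; rewrite in_itv/= => /andP[tauts tsT] [cxs xsrho] Vmax.
have ts0 : 0 < ts := lt_le_trans tau_gt0 tauts.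
have VC t x : tau <= t -> t <= T -> C0 x -> V t x <= V ts xs.
  by move=> h1 h2 h3; apply: (Vmax (t, x)); rewrite inE; split => //=; rewrite in_itv/= h1.
have Vs : 0 < V ts xs.
  apply: (lt_le_trans V1); apply: VC => //; first by rewrite ge_min lexx orbT.
  by split; [exact: subset_closure|exact: Vrho V1].
have zs : th < E ts * z ts xs.
  move: Vs; rewrite subr_gt0; apply: le_lt_trans.
  by rewrite -[leLHS]mulr1 ler_pM2l// lerDl sqn_ge0.
have zs0 : 0 < z ts xs by rewrite -(pmulr_rgt0 _ (E0 ts)) (lt_trans th0).
have Oxs : Omega xs.
  apply: not_boundary => // bxs; move: zs0; rewrite ltNge zb//.
  by rewrite ts0.
have tsgt : tau < ts.
  rewrite lt_neqAle tauts andbT; apply/eqP => tsE.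
  by move: Vs; rewrite ltNge Vtau// -tsE tau_gt0 lexx.
have Vglob t x : 0 < t <= T -> Omega x -> V t x <= V ts xs.
  move=> tT Ox; have [V0|V0] := lerP (V t x) 0; first exact: le_trans (ltW Vs).
  have xr := Vrho _ _ tT Ox V0.
  have [ht|ht] := lerP t tau; last first.
    apply: VC => //; [exact: ltW|by case/andP: tT|].
    by split => //; exact: subset_closure.
  by move: V0; rewrite ltNge Vtau//; case/andP: tT => // -> _; rewrite ht.
have tsT' : 0 < ts <= T by rewrite ts0.
have [ze [d [D [zeE zele dze Dze dD]]]] := zeq _ _ tsT' Oxs zs0.
(* Only times s <= ts are compared, since ts = T is possible; the penalty does not depend on time
   and drops out. *)
have time : 0 <= E ts * (d - L * z ts xs).
  apply: (@derive_max_left R (fun s => E s * ze s xs) ts 0) => //.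
    have dE : is_derive ts (1 : R) E (- L * E ts).
      have -> : E = expR \o ((- L) \*: @idfun R).
        by apply/funext => s; rewrite /E /= /GRing.scale/= mulNr.
      apply: is_derive_eq; rewrite /GRing.scale/=; rewrite /E !mulr1 mulNr.
      by ring.
    apply: is_derive_eq; rewrite /GRing.scale/= zeE; ring.
  move=> s /andP[s0 sts]; have sT : 0 < s <= T by rewrite s0 (le_trans sts).
  have := Vglob _ _ sT Oxs; rewrite /V lerD2r -zeE; apply: le_trans.
  by rewrite ler_pM2l// zele.
have space i : E ts * D i - th * 2 <= 0.
  have /= := second_derive_linear (E ts) (- th) (Dze i)
    (second_derive_sqn xs i).
  rewrite mulNr => /second_derive_max; apply.
  have := near_line i oO Oxs; apply: filterS => s Os.
  rewrite scale0r addr0 !mulNr.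
  have := Vglob _ _ tsT' Os; rewrite /V !mulrDr !mulr1 zeE => h.
  have : E ts * ze ts (xs + s *: delta_mx 0 i)
      <= E ts * z ts (xs + s *: delta_mx 0 i).
    by rewrite ler_pM2l// zele.
  lra.
have spaces : E ts * \sum_i D i <= th * n.*2%:R.
  rewrite mulr_sumr; apply: (@le_trans _ _ (\sum_(i < n) (th * 2))).
    by apply: ler_sum => i _; rewrite -subr_le0.
  by rewrite sumr_const card_ord -mulrnAr -mulrnA mul2n.
have : E ts * (L * z ts xs) <= E ts * (K * z ts xs) + th * n.*2%:R.
  move: time; rewrite mulrBr subr_ge0 => /le_trans; apply.
  have : E ts * (d - \sum_i D i) <= E ts * (K * z ts xs) by rewrite ler_pM2l.
  rewrite mulrBr; by lra.
rewrite /L !mulrDl !mulrDr mul1r.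
have : th * n.*2%:R <= E ts * (n.*2%:R * z ts xs).
  by rewrite mulrCA mulrC ler_wpM2l// ltW.
have := lt_trans th0 zs.
lra.
Unshelve. all: by end_near. Qed.
End maximum_principle.

(** * Lebesgue measure on R^n *)

Section measure_rV.
Context {R : realType}.

Lemma measurable_ball_rV n (c : 'rV[R]_n) (e : R) : 0 < e -> measurable (ball c e).
Proof.
move=> e0.
rewrite (_ : ball c e = \bigcap_(i in [set: 'I_n]) [set y | `|c 0 i - y 0 i| < e]).
  apply: fin_bigcap_measurable => // i _.
  rewrite -[X in measurable X]setTI.
  apply: (@measurable_coord R n i measurableT (ball (c 0 i) e)).
  exact: measurable_ball.
apply/seteqP; split=> [y [_ cy] i _|y cy]; first exact: cy.
by split => // i j; rewrite ord1; exact: cy.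
Qed.

(** The sigma-algebra is generated by the coordinates, so balls of the maximum norm are measurable
    boxes. An open set is the union of those with rational centre and radius 1/(k+1) that it
    contains, enumerated through [unpickle]. *)
Lemma measurable_open_rV n (U : set 'rV[R]_n) : open U -> measurable U.
Proof.
move=> oU.
pose B (c : 'rV[rat]_n * nat) := ball (map_mx (@ratr R) c.1) (c.2.+1%:R^-1 : R).
pose F k := if unpickle k is Some c then
  if `[< B c `<=` U >] then B c else set0 else set0.
rewrite (_ : U = \bigcup_k F k).
  apply: bigcup_measurable => k _; rewrite /F.
  case: unpickle => // c; case: ifP => // _; apply: measurable_ball_rV.
  by rewrite invr_gt0.
apply/seteqP; split=> [x Ux|x [k _]]; last first.
  by rewrite /F; case: unpickle => // c; case: ifP => // /asboolP; apply.
have /nbhs_ballP[e /= e0 eU] : nbhs x U by exact: open_nbhs_nbhs.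
have e20 : 0 < e / 2 by rewrite divr_gt0.
have [m _ me] := @near_infty_natSinv_lt R (PosNum e20).
have /(_ m (leqnn m)) /= {}me := me.
pose d : R := m.+1%:R^-1.
have d0 : 0 < d by rewrite invr_gt0.
have : forall i, exists r : rat, `|x 0 i - ratr r| < d.
  move=> i; have xd : x 0 i - d < x 0 i + d by rewrite ltrBlDr -addrA ltrDl addr_gt0.
  have [r] := rat_in_itvoo xd; rewrite in_itv/= => /andP[h1 h2].
  by exists r; rewrite ltr_distlC h1 h2.
move=> /choice[r xr].
pose c := (\row_i r i, m).
exists (pickle c) => //; rewrite /F pickleK ifT.
  by split => // i j; rewrite ord1 !mxE /ball/= distrC; exact: xr.
apply/asboolP => y [_ cy]; apply: eU; split => // i j; rewrite ord1.
have := cy 0 j; rewrite !mxE /ball /= => yj.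
rewrite (le_lt_trans (ler_distD (ratr (r j)) _ _))// [ltRHS]splitr ltrD//.
  exact: lt_trans (xr j) me.
exact: lt_trans yj me.
Qed.

Lemma measurable_fun_open_rV n (D : set 'rV[R]_n) (f : 'rV[R]_n -> R) : open D ->
  (forall x, D x -> {for x, continuous f}) -> measurable_fun D f.
Proof.
move=> oD cf; apply: (measurability _ (RGenOInfty.measurableE R)).
move=> /= _ [_ [a ->]] <-; apply: measurable_open_rV.
rewrite openE => x [Dx]; rewrite /= in_itv/= andbT => fx.
apply: filterI; first exact: open_nbhs_nbhs.
have /cvgr_gt /(_ _ fx) := cf _ Dx.
by apply: filterS => y /=; rewrite in_itv/= andbT.
Qed.

Lemma measurable_continuous_rV n (f : 'rV[R]_n -> R) :
  continuous f -> measurable_fun setT f.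
Proof. by move=> cf; apply: measurable_fun_open_rV => [|x _]; [exact: openT|exact: cf]. Qed.

Lemma measurable_prod_rV n (f : 'I_n -> R -> R) :
  (forall i, measurable_fun setT (f i)) ->
  measurable_fun setT (fun y : 'rV[R]_n => \prod_i f i (y 0 i)).
Proof.
move=> mf; apply: measurable_prod => i _.
by apply: (measurableT_comp (mf i)); exact: measurable_coord.
Qed.

(* Tonelli along the recursion that defines [lebesgue_rV]. *)
Lemma integral_prod_rV n (f : 'I_n -> R -> R) (r : 'I_n -> R) :
  (forall i, measurable_fun setT (f i)) -> (forall i s, 0 <= f i s) ->
  (forall i, \int[@lebesgue_measure R]_s (f i s)%:E = (r i)%:E)%E ->
  (\int[@lebesgue_rV R n]_y (\prod_i f i (y 0 i))%:E = (\prod_i r i)%:E)%E.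
Proof.
elim: n f r => [|n IH] f r mf f0 fr.
  rewrite /= integral_dirac//=.
    by rewrite diracT mul1e !big_ord0.
  by apply/measurable_EFinP; exact: measurable_prod_rV.
rewrite /= ge0_integral_pushforward//=; last 3 first.
- exact: measurable_rV_cons.
- by apply/measurable_EFinP; exact: measurable_prod_rV.
- by move=> y _; rewrite lee_fin prodr_ge0.
rewrite preimage_setT.
rewrite (eq_integral (fun z : measurableTypeR R * 'rV[R]_n =>
  ((f 0 z.1)%:E * (\prod_i f (lift 0 i) (z.2 0 i))%:E)%E)); last first.
  move=> z _; rewrite /= big_ord_recl /rV_cons mxE unlift_none EFinM.
  rewrite (eq_bigr (fun i => f (lift 0 i) (z.2 0 i)))// => i _.
  by rewrite mxE liftK.
have mp : measurable_fun setT (fun y : 'rV[R]_n => \prod_i f (lift 0 i) (y 0 i)).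
  exact: (@measurable_prod_rV n (fun i => f (lift 0 i))).
rewrite fubini_tonelli1/=.
- rewrite /fubini_F /=.
  under eq_integral => s _.
    rewrite ge0_integralZl//=; last 3 first.
    - exact/measurable_EFinP.
    - by move=> y _; rewrite lee_fin prodr_ge0.
    - by rewrite lee_fin.
    rewrite (IH (fun i => f (lift 0 i)) (fun i => r (lift 0 i)))//.
    over.
  rewrite ge0_integralZr//=.
  + by rewrite fr big_ord_recl EFinM.
  + by apply/measurable_EFinP; exact: mf.
  + by move=> s _; rewrite lee_fin.
  + rewrite lee_fin prodr_ge0// => i _; rewrite -lee_fin -fr.
    by apply: integral_ge0 => s _; rewrite lee_fin.
- apply: emeasurable_funM; apply/measurable_EFinP.
    by apply: (measurableT_comp (mf 0)); exact: measurable_fst.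
  by apply: (measurableT_comp mp); exact: measurable_snd.
- by move=> z; rewrite -EFinM lee_fin mulr_ge0// prodr_ge0.
Qed.

Lemma lebesgue_ball_rV n (c : 'rV[R]_n) (e : R) : 0 < e ->
  @lebesgue_rV R n (ball c e) = ((2 * e) ^+ n)%:E.
Proof.
move=> e0; rewrite -[LHS]mul1e -(setIT (ball c e)) -integral_indic//; last first.
  exact: measurable_ball_rV.
pose f (i : 'I_n) (s : R) : R := \1_(ball (c 0 i) e) s.
rewrite mul1e (eq_integral (fun y : 'rV[R]_n => (\prod_i f i (y 0 i))%:E)); last first.
  move=> y _; congr EFin; rewrite /f indicE.
  have [yc|yc] := pselect (ball c e y).
    rewrite mem_set// big1// => i _; rewrite indicE mem_set//.
    by case: yc => _; exact.
  rewrite memNset//; apply/esym/eqP; rewrite prodf_seq_eq0.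
  apply/hasP; apply: contra_notP yc => h; split => // j i; rewrite ord1.
  apply: contrapT => yci; apply: h; exists i; first by rewrite mem_index_enum.
  by rewrite /f indicE memNset// eqxx.
rewrite (@integral_prod_rV n f (fun => 2 * e)) ?prodr_const ?card_ord//.
- by move=> i; apply: measurable_indic; exact: measurable_ball.
- move=> i; rewrite /f integral_indic//; last exact: measurable_ball.
  by rewrite setIT mulr_natl; exact: lebesgue_measure_ball (ltW e0).
Qed.

Lemma lebesgue_open_gt0 n (U : set 'rV[R]_n) : open U -> U !=set0 ->
  (0 < @lebesgue_rV R n U)%E.
Proof.
move=> oU [x Ux]; have /nbhs_ballP[e /= e0 eU] : nbhs x U by exact: open_nbhs_nbhs.
apply: (@lt_le_trans _ _ (lebesgue_rV n (ball x e))).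
  by rewrite lebesgue_ball_rV// lte_fin exprn_gt0// mulr_gt0.
apply: le_measure => //; rewrite inE.
  exact: measurable_ball_rV.
exact: measurable_open_rV.
Qed.

End measure_rV.

(* Dominated convergence along the neighbourhood filter of a point of a
   pseudometric space, by extracting a sequence. *)
Lemma continuous_Rintegral {R : realType} d (Y : measurableType d)
    (mu : {measure set Y -> \bar R}) (T : pseudoMetricType R)
    (f : T -> Y -> R) (h : Y -> R) (a : T) :
  (forall x, measurable_fun setT (f x)) ->
  mu.-integrable setT (EFin \o h) ->
  (\forall x \near a, forall y, `|f x y| <= h y) ->
  (forall y, f x y @[x --> a] --> f a y) ->
  (\int[mu]_y f x y)%R @[x --> a] --> (\int[mu]_y f a y)%R.
Proof.
move=> mf ih fh fa; apply/cvgrPdist_lt => e e0; apply: contrapT => nF.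
have : forall k : nat, exists x, [/\ ball a (k.+1%:R^-1 : R) x,
    forall y, `|f x y| <= h y &
    e <= `|(\int[mu]_y f a y)%R - (\int[mu]_y f x y)%R| ].
  move=> k; apply: contrapT => nx; apply: nF.
  have : \forall x \near a, ball a (k.+1%:R^-1 : R) x.
    by apply: nbhsx_ballx; rewrite invr_gt0.
  apply: filterS2 fh => x hx bx; rewrite ltNge; apply/negP => ex.
  by apply: nx; exists x.
move=> /choice[x /all_and3[ax hx ex]].
have xa : x k @[k --> \oo] --> a.
  apply/cvg_ballP => r r0.
  have [N _ Nr] := @near_infty_natSinv_lt R (PosNum r0).
  exists N => // k /Nr /= kr; apply: le_ball (ax k); exact: ltW.
have [|||||_ _] := @dominated_convergence _ _ _ mu setT measurableT
  (fun k y => (f (x k) y)%:E) (fun y => (f a y)%:E) (fun y => (h y)%:E).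
- by move=> k; exact/measurable_EFinP.
- exact/measurable_EFinP.
- apply: aeW => y _; apply: cvg_EFin; first by near=> k.
  exact: (cvg_comp _ (f^~ y) xa (fa y)).
- exact: ih.
- by apply: aeW => y k _; rewrite lee_fin; exact: hx.
have fin : (\int[mu]_y (f a y)%:E)%E \is a fin_num.
  apply: integrable_fin_num => //; apply: (le_integrable measurableT _ _ ih).
    exact/measurable_EFinP.
  move=> y _; rewrite lee_fin (le_trans _ (ler_norm _))//.
  exact: (nbhs_singleton fh).
rewrite -(fineK fin) => /fine_cvgP[_] /cvgrPdist_lt /(_ _ e0) [N _ /(_ N (leqnn N))].
by rewrite /= ltNge => /negP; apply; exact: ex.
Unshelve. all: by end_near. Qed.

(** * Heat kernel *)

Section heat_kernel.
Context {R : realType} {n : nat}.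
Implicit Types (x y : 'rV[R]_n) (t s : R).
Local Notation mu := (@lebesgue_rV R n).

Definition gauss s (v : R) : R := expR (- (v / (4 * s))).

(** This is (4 pi t)^(-n/2), written as an exponential so that positivity is immediate. *)
Definition heat_cst t : R := expR (- (n%:R / 2 * ln (4 * pi * t))).

Definition heatk t x y := heat_cst t * gauss t (sqn (x - y)).

Lemma heat_cst_gt0 t : 0 < heat_cst t. Proof. exact: expR_gt0. Qed.

Lemma gauss_gt0 s v : 0 < gauss s v. Proof. exact: expR_gt0. Qed.

Lemma heatk_gt0 t x y : 0 < heatk t x y.
Proof. exact: mulr_gt0 (heat_cst_gt0 t) (gauss_gt0 _ _). Qed.

(** In each coordinate the kernel is a normal density of variance 2 t; its total mass 1 then follows
    from dimension one by Tonelli. *)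
Lemma heatk_prod t x y : 0 < t ->
  heatk t x y = \prod_i normal_pdf (x 0 i) (Num.sqrt (2 * t)) (y 0 i).
Proof.
move=> t0; have s0 : Num.sqrt (2 * t) != 0 by rewrite gt_eqF// sqrtr_gt0 mulr_gt0.
have pit : 0 < 4 * pi * t by rewrite !mulr_gt0// pi_gt0.
under eq_bigr do rewrite normal_pdfE//.
rewrite big_split/= prodr_const card_ord /normal_peak /normal_fun.
rewrite sqr_sqrtr; last by rewrite mulr_ge0// ltW.
rewrite -expR_sum /heatk; congr (_ * _).
  rewrite -[X in _ = X ^+ n]lnK; last first.
    by rewrite posrE invr_gt0 sqrtr_gt0 pmulrn_rgt0// !mulr_gt0// pi_gt0.
  rewrite -expRM_natl; congr expR.
  rewrite (_ : 2 * t * pi *+ 2 = 4 * pi * t); last by rewrite -mulr_natr; ring.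
  rewrite lnV ?posrE ?sqrtr_gt0// -powR12_sqrt ?ltW// ln_powR mulrN; congr (- _).
  by rewrite mulrA.
congr expR; rewrite /sqn mulr_suml -sumrN; apply: eq_bigr => i _.
rewrite !mxE mulNr; congr (- (_ / _)); first by rewrite -sqrrN opprB.
by rewrite -mulr_natr; ring.
Qed.

Lemma continuous_gauss (C : R) s : continuous (fun v => C * gauss s v).
Proof.
move=> v; apply: cvgMl_tmp.
apply: (@continuous_comp _ _ _ (fun v : R => - (v / (4 * s))) expR).
  by apply: cvgN; apply: cvgMr_tmp; exact: cvg_id.
exact: continuous_expR.
Qed.

Lemma measurable_heatk t x : measurable_fun setT (heatk t x).
Proof.
apply: measurable_continuous_rV => y.
apply: (@continuous_comp _ _ _ (fun y => sqn (x - y))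
  (fun v => heat_cst t * gauss t v)); last exact: continuous_gauss.
apply: (@continuous_comp _ _ _ (fun y => x - y) sqn); last exact: sqn_continuous.
by apply: (@cvgB _ _ _ (nbhs y)); [exact: cvg_cst|exact: cvg_id].
Qed.

Lemma integral_heatk t x : 0 < t -> (\int[mu]_y (heatk t x y)%:E = 1)%E.
Proof.
move=> t0; under eq_integral do rewrite heatk_prod//.
pose f (i : 'I_n) := normal_pdf (x 0 i) (Num.sqrt (2 * t)).
rewrite (@integral_prod_rV R n f (fun => 1)).
- by rewrite big1.
- by move=> i; exact: measurable_normal_pdf.
- by move=> i r; exact: normal_pdf_ge0.
- by move=> i; exact: integral_normal_pdf.
Qed.

Lemma integrable_heatk t x : 0 < t -> mu.-integrable setT (EFin \o heatk t x).
Proof.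
move=> t0; apply/integrableP; split.
  by apply/measurable_EFinP; exact: measurable_heatk.
under eq_integral => y _ do rewrite /= ger0_norm ?ltW ?heatk_gt0//.
by rewrite integral_heatk// ltry.
Qed.

Lemma Rintegral_heatk t x : 0 < t -> (\int[mu]_y heatk t x y)%R = 1.
Proof. by move=> t0; rewrite /Rintegral integral_heatk. Qed.

Lemma integrable_gauss s x (C : R) : 0 < s ->
  mu.-integrable setT (EFin \o (fun y => C * gauss s (sqn (x - y)))).
Proof.
move=> s0; have := integrableZl measurableT (C / heat_cst s) (integrable_heatk x s0).
apply: eq_integrable => // y _ /=; rewrite -EFinM; congr EFin.
by rewrite /heatk mulrA divfK// gt_eqF// heat_cst_gt0.
Qed.

Lemma integrable_dominated (f : 'rV[R]_n -> R) s x (C : R) : 0 < s ->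
  measurable_fun setT f -> (forall y, `|f y| <= C * gauss s (sqn (x - y))) ->
  mu.-integrable setT (EFin \o f).
Proof.
move=> s0 mf fC; apply: (le_integrable measurableT _ _ (integrable_gauss x C s0)).
  exact/measurable_EFinP.
by move=> y _; rewrite lee_fin (le_trans (fC y))// ler_norm.
Qed.

(** [gauss s] is the square of [gauss (2 * s)], and one of the two factors absorbs v because r <=
    exp r. Doubling the time is the price of the polynomial factors in the derivatives of the
    kernel. *)
Lemma mul_gauss_le s v : 0 < s -> 0 <= v -> v * gauss s v <= 8 * s * gauss (2 * s) v.
Proof.
move=> s0 v0; have -> : gauss s v = gauss (2 * s) v * gauss (2 * s) v.
  by rewrite /gauss -expRD; congr expR; field; rewrite gt_eqF.
rewrite mulrA ler_pM2r ?gauss_gt0// /gauss expRN ler_pdivrMr ?expR_gt0//.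
rewrite -ler_pdivrMl ?mulr_gt0//.
have := expR_ge1Dx (v / (4 * (2 * s))).
rewrite (_ : 8 * s = 4 * (2 * s)); last by ring.
by move=> h; rewrite mulrC; lra.
Qed.

Lemma le_gauss s t v : 0 < s -> s <= t -> 0 <= v -> gauss s v <= gauss t v.
Proof.
move=> s0 st v0; rewrite ler_expR lerN2 ler_wpM2l// lef_pV2 ?posrE ?mulr_gt0//.
  by rewrite ler_pM2l.
exact: lt_le_trans st.
Qed.

Lemma sqnD x y : sqn (x + y) <= 2 * sqn x + 2 * sqn y.
Proof.
rewrite /sqn !mulr_sumr -big_split/=; apply: ler_sum => i _; rewrite mxE.
by rewrite -subr_ge0 (_ : _ - _ = (x 0 i - y 0 i) ^+ 2) ?sqr_ge0//; ring.
Qed.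

Lemma sqnBC x y : sqn (x - y) = sqn (y - x).
Proof. by apply: eq_bigr => i _; rewrite !mxE -sqrrN opprB. Qed.

(** Follows from |x - y|^2 <= 2 |x' - y|^2 + 2 |x' - x|^2. One Gaussian centred at x thus dominates
    those centred at all x' nearby, as limits and derivatives under the integral require. *)
Lemma gauss_shift s x x' y : 0 < s -> sqn (x' - x) <= 1 ->
  gauss s (sqn (x' - y)) <= expR (s^-1) * gauss (2 * s) (sqn (x - y)).
Proof.
move=> s0 xx; rewrite /gauss -expRD ler_expR.
have h : sqn (x - y) <= 2 * sqn (x' - y) + 2.
  have := sqnD (x' - y) (x - x').
  rewrite (_ : x' - y + _ = x - y); last by rewrite addrC addrA subrK.
  by rewrite [sqn (x - x')]sqnBC; lra.
rewrite -subr_ge0 (_ : _ - _ = (2 * sqn (x' - y) + 8 - sqn (x - y)) / (8 * s)).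
  by rewrite divr_ge0// ?mulr_ge0// ?ltW//; lra.
by field; rewrite gt_eqF.
Qed.

Lemma heat_cst_le s t : 0 < s -> s <= t -> heat_cst t <= heat_cst s.
Proof.
move=> s0 st; rewrite ler_expR lerN2 ler_wpM2l ?divr_ge0//.
have t0 := lt_le_trans s0 st.
by rewrite ler_ln ?posrE ?mulr_gt0 ?pi_gt0// ler_pM2l// mulr_gt0 ?pi_gt0.
Qed.

(** Half of the exponent becomes the small factor exp(-r / (8 t)), the other half the kernel at time
    2 t, and 2^(n/2) compares the normalisations. Far contributions are thus controlled by a kernel
    of mass 1. *)
Lemma heatk_tail t x y (r : R) : 0 < t -> r <= sqn (x - y) ->
  heatk t x y <= expR (n%:R / 2 * ln 2 - r / (8 * t)) * heatk (2 * t) x y.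
Proof.
move=> t0 rxy; rewrite /heatk /heat_cst /gauss -!expRD ler_expR.
rewrite (_ : 4 * pi * (2 * t) = 2 * (4 * pi * t)); last by ring.
rewrite (@lnM _ 2) ?posrE ?mulr_gt0 ?pi_gt0//.
have : r / (8 * t) <= sqn (x - y) / (8 * t) by rewrite ler_pM2r// invr_gt0 mulr_gt0.
rewrite (_ : sqn (x - y) / (4 * t) = sqn (x - y) / (4 * (2 * t)) + sqn (x - y) / (8 * t)).
  rewrite [_ * (ln 2 + _)]mulrDr.
  move: (_ / (8 * t)) (sqn (x - y) / (8 * t)) (_ / (4 * (2 * t))) => a b c.
  move: (n%:R / 2 * ln 2) (n%:R / 2 * ln (4 * pi * t)) => d e; lra.
by field; rewrite gt_eqF.
Qed.

End heat_kernel.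

Section heat_kernel_derivatives.
Context {R : realType} {n : nat}.
Implicit Types (x y : 'rV[R]_n) (t s : R).

Lemma is_derive_heatk_time t x y : 0 < t ->
  is_derive t (1 : R) (fun r => heatk r x y)
    ((sqn (x - y) / (4 * t ^+ 2) - n%:R / (2 * t)) * heatk t x y).
Proof.
move=> t0; have pit : 0 < 4 * pi * t by rewrite !mulr_gt0// pi_gt0.
have d1 := is_deriveZ (4 * pi) (is_derive_id t (1 : R)).
have d2 : is_derive t (1 : R) (fun r : R => ln (4 * pi * r)) t^-1.
  apply: is_derive_eq (is_derive1_comp (is_derive1_ln pit) d1) _.
  by rewrite /GRing.scale/= mulr1 invfM mulrAC mulVf ?mul1r// gt_eqF ?mulr_gt0 ?pi_gt0.
have d3 : is_derive t (1 : R) (fun r : R => - (n%:R / 2 * ln (4 * pi * r)))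
    (- (n%:R / 2 * t^-1)).
  exact: is_derive_eq (is_deriveN (is_deriveZ (n%:R / 2) d2)) _.
have t40 : 4 * t != 0 by rewrite gt_eqF// mulr_gt0.
have d4 : is_derive t (1 : R) (fun r : R => (4 * r)^-1) (- (4 / (4 * t) ^+ 2)).
  apply: is_derive_eq (is_deriveV _ (is_deriveZ 4 (is_derive_id t (1 : R)))) _.
    exact: t40.
  by rewrite /GRing.scale/= mulr1 mulrC mulrN.
have d5 : is_derive t (1 : R) (fun r : R => - (sqn (x - y) / (4 * r)))
    (sqn (x - y) / (4 * t ^+ 2)).
  apply: is_derive_eq (is_deriveN (is_deriveZ (sqn (x - y)) d4)) _.
  by rewrite /GRing.scale/=; field; rewrite gt_eqF.
apply: is_derive_eq (is_deriveM (is_derive1_comp (is_derive_expR _) d3)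
  (is_derive1_comp (is_derive_expR _) d5)) _.
rewrite /GRing.scale/= /heatk /heat_cst /gauss.
by field; rewrite gt_eqF.
Qed.

Lemma is_derive_gauss_line (c t V b s : R) : t != 0 ->
  is_derive s (1 : R) (fun s => c * gauss t (V + 2 * b * s + s ^+ 2))
    (- ((b + s) / (2 * t)) * (c * gauss t (V + 2 * b * s + s ^+ 2))).
Proof.
move=> t0.
have d1 : is_derive s (1 : R) (fun s => V + 2 * b * s) (2 * b).
  apply: is_derive_eq (is_deriveD (is_derive_cst V s (1 : R))
    (is_deriveZ (2 * b) (is_derive_id s (1 : R)))) _.
  by rewrite add0r /GRing.scale/= mulr1.
have d2 : is_derive s (1 : R) (fun s => V + 2 * b * s + s ^+ 2) (2 * b + 2 * s).
  apply: is_derive_eq (is_deriveD d1 (is_deriveX 2 (is_derive_id s (1 : R)))) _.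
  by rewrite expr1 /GRing.scale/= mulr1.
have d3 : is_derive s (1 : R) (fun s => - ((V + 2 * b * s + s ^+ 2) / (4 * t)))
    (- ((b + s) / (2 * t))).
  apply: is_derive_eq (is_deriveN (is_deriveM d2 (is_derive_cst (4 * t)^-1 s (1 : R)))) _.
  by rewrite scaler0 add0r /GRing.scale/=; field.
apply: is_derive_eq (is_deriveZ c (is_derive1_comp (is_derive_expR _) d3)) _.
by rewrite /GRing.scale/= /gauss; ring.
Qed.

Lemma is_derive2_gauss_line (c t V b s : R) : t != 0 ->
  is_derive s (1 : R)
    (fun s => - ((b + s) / (2 * t)) * (c * gauss t (V + 2 * b * s + s ^+ 2)))
    (((b + s) ^+ 2 / (4 * t ^+ 2) - (2 * t)^-1) *
      (c * gauss t (V + 2 * b * s + s ^+ 2))).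
Proof.
move=> t0.
have d1 : is_derive s (1 : R) (fun s => - ((b + s) / (2 * t))) (- (2 * t)^-1).
  apply: is_derive_eq (is_deriveN (is_deriveM
    (is_deriveD (is_derive_cst b s (1 : R)) (is_derive_id s (1 : R)))
    (is_derive_cst (2 * t)^-1 s (1 : R)))) _.
  by rewrite scaler0 !add0r /GRing.scale/= mulr1.
apply: is_derive_eq (is_deriveM d1 (is_derive_gauss_line c V b s t0)) _.
by rewrite /GRing.scale/=; field.
Qed.

Lemma poly_gauss_le (A B s v : R) : 0 < s -> 0 <= A -> 0 <= B -> 0 <= v ->
  (A + B * v) * gauss s v <= (A + 8 * s * B) * gauss (2 * s) v.
Proof.
move=> s0 A0 B0 v0; rewrite [leLHS]mulrDl [leRHS]mulrDl lerD//.
  by apply: ler_wpM2l => //; apply: le_gauss => //; lra.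
rewrite -[leLHS]mulrA (mulrC _ B) -[leRHS]mulrA ler_wpM2l//; exact: mul_gauss_le.
Qed.

Lemma poly_gauss_shift (A B s : R) x x' y : 0 < s -> 0 <= A -> 0 <= B ->
  sqn (x' - x) <= 1 -> (A + B * sqn (x' - y)) * gauss s (sqn (x' - y)) <=
    (A + 8 * s * B) * expR ((2 * s)^-1) * gauss (4 * s) (sqn (x - y)).
Proof.
move=> s0 A0 B0 xx; rewrite (le_trans (poly_gauss_le s0 A0 B0 (sqn_ge0 _)))//.
rewrite -[leRHS]mulrA; apply: ler_wpM2l.
  by rewrite addr_ge0// !mulr_ge0// ltW.
have -> : 4 * s = 2 * (2 * s) by ring.
by apply: gauss_shift => //; rewrite mulr_gt0.
Qed.

End heat_kernel_derivatives.

(** * Heat potentials *)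

Section heat_potential.
Context {R : realType} {n : nat}.
Implicit Types (x y : 'rV[R]_n) (t s : R).
Local Notation mu := (@lebesgue_rV R n).
Local Notation hcst := (@heat_cst R n).

Definition heatp (g : 'rV[R]_n -> R) t x := (\int[mu]_y (heatk t x y * g y))%R.

Context (g : 'rV[R]_n -> R) (M : R) (mg : measurable_fun setT g)
  (g0 : forall y, 0 <= g y) (gM : forall y, g y <= M).

Let M0 : 0 <= M. Proof. exact: le_trans (g0 0) (gM 0). Qed.

Lemma dominated_mul (f : 'rV[R]_n -> R) s x (C : R) :
  (forall y, `|f y| <= C * gauss s (sqn (x - y))) ->
  forall y, `|f y * g y| <= C * M * gauss s (sqn (x - y)).
Proof.
move=> fC y; rewrite normrM mulrAC ler_pM// ger0_norm//.
Qed.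

Lemma integrable_dominated_mul (f : 'rV[R]_n -> R) s x (C : R) : 0 < s ->
  measurable_fun setT f -> (forall y, `|f y| <= C * gauss s (sqn (x - y))) ->
  mu.-integrable setT (EFin \o (fun y => f y * g y)).
Proof.
move=> s0 mf fC; apply: (integrable_dominated s0 _ (dominated_mul fC)).
exact: measurable_funM.
Qed.

Lemma integrable_heatk_mul t x : 0 < t ->
  mu.-integrable setT (EFin \o (fun y => heatk t x y * g y)).
Proof.
move=> t0; apply: (@integrable_dominated_mul _ t x (hcst t)) => //.
  exact: measurable_heatk.
by move=> y; rewrite gtr0_norm ?heatk_gt0//; exact: lexx.
Qed.

Lemma heatp_ge0 t x : 0 <= heatp g t x.
Proof. by apply: Rintegral_ge0 => y _; rewrite mulr_ge0// ltW// heatk_gt0. Qed.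

(** Differentiation under the integral sign, where the parameter will be either the time or the
    position on a coordinate line; Gaussians in y fixed for the whole interval dominate f and df. *)
Lemma is_derive_Rintegral (f df : R -> 'rV[R]_n -> R) (u a v s C D : R) x :
  u < a < v -> 0 < s ->
  (forall r, u < r < v -> measurable_fun setT (f r)) ->
  (forall r y, u < r < v -> is_derive r (1 : R) (f^~ y) (df r y)) ->
  (forall r y, u < r < v -> `|f r y| <= C * gauss s (sqn (x - y))) ->
  (forall r y, u < r < v -> `|df r y| <= D * gauss s (sqn (x - y))) ->
  is_derive a (1 : R) (fun r => (\int[mu]_y (f r y * g y))%R)
    (\int[mu]_y (df a y * g y))%R.
Proof.
move=> uav s0 mf dfd fC dfD.
pose F r y := f r y * g y.
have dF r y : u < r < v -> is_derive r (1 : R) (F^~ y) (df r y * g y).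
  move=> rv; have := dfd r y rv => ?.
  apply: is_derive_eq (is_deriveM (dfd r y rv) (is_derive_cst (g y) r (1 : R))) _.
  by rewrite scaler0 add0r /GRing.scale/= mulrC.
have Ia : `]u, v[%classic a by rewrite /= in_itv.
have intF r : `]u, v[%classic r -> mu.-integrable setT (EFin \o F r).
  rewrite /= in_itv/= => ruv; apply: (@integrable_dominated_mul _ s x C) => //.
    exact: mf.
  by move=> y; exact: fC.
have derF r y : `]u, v[%classic r -> setT y -> derivable (F^~ y) r 1.
  by rewrite /= in_itv/= => ruv _; have [] := dF r y ruv.
have D0 : 0 <= D.
  have := le_trans (normr_ge0 _) (dfD a 0 uav).
  by rewrite pmulr_lge0// gauss_gt0.
pose G y := D * M * gauss s (sqn (x - y)).
have G0 y : 0 <= G y by rewrite !mulr_ge0// ltW// gauss_gt0.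
have iG : mu.-integrable setT (EFin \o G) by exact: integrable_gauss.
have GF r y : `]u, v[%classic r -> setT y -> `|partial1of2 F r y| <= G y.
  rewrite /= in_itv/= => ruv _; rewrite partial1of2E.
  have [_ ->] := dF r y ruv; apply: (@dominated_mul (df r)) => {}y.
  exact: dfD.
apply: DeriveDef; first exact: (derivable_under_integral measurableT Ia intF derF G0 iG GF).
rewrite -derive1E (differentiation_under_integral measurableT Ia intF derF G0 iG GF).
apply: eq_Rintegral => y _; rewrite partial1of2E.
by have [_ ->] := dF a y uav.
Qed.

Lemma heatk_line t x i y s : heatk t (x + s *: delta_mx 0 i) y =
  hcst t * gauss t (sqn (x - y) + 2 * (x - y) 0 i * s + s ^+ 2).
Proof. by rewrite /heatk addrAC sqn_shift. Qed.

Lemma is_derive_heatp_time t x : 0 < t -> is_derive t (1 : R) (heatp g ^~ x)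
  (\int[mu]_y ((sqn (x - y) / (4 * t ^+ 2) - n%:R / (2 * t)) * heatk t x y * g y))%R.
Proof.
move=> t0.
(* For t/2 < r < 2 t the normalisation is at most its value at t/2 and the Gaussian at most that at
   2 t; the time doubles once more to absorb the polynomial. The kernel itself is the case A = 1, B
   = 0. *)
have h (A B : R) r y : 0 <= A -> 0 <= B -> t / 2 < r < 2 * t ->
   (A + B * sqn (x - y)) * heatk r x y <=
   (hcst (t / 2) * (A + 8 * (2 * t) * B)) * gauss (2 * (2 * t)) (sqn (x - y)).
  move=> A0 B0 /andP[r1 r2]; rewrite /heatk mulrCA -[leRHS]mulrA.
  have t20 : 0 < t / 2 by rewrite divr_gt0.
  have r0 : 0 < r := lt_trans t20 r1.
  have AB : 0 <= A + B * sqn (x - y) by rewrite addr_ge0// mulr_ge0// sqn_ge0.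
  apply: ler_pM.
  - exact: ltW (heat_cst_gt0 _).
  - by rewrite mulr_ge0// ltW// gauss_gt0.
  - exact: heat_cst_le (ltW r1).
  apply: (@le_trans _ _ ((A + B * sqn (x - y)) * gauss (2 * t) (sqn (x - y)))).
    by apply: ler_wpM2l => //; apply: le_gauss; [| exact: ltW|exact: sqn_ge0].
  by apply: poly_gauss_le; rewrite ?sqn_ge0 ?mulr_gt0.
apply: (@is_derive_Rintegral (fun r => heatk r x)
  (fun r y => (sqn (x - y) / (4 * r ^+ 2) - n%:R / (2 * r)) * heatk r x y)
  (t / 2) t (2 * t) (2 * (2 * t))
  (hcst (t / 2) * (1 + 8 * (2 * t) * 0))
  (hcst (t / 2) * (n%:R / t + 8 * (2 * t) * (t ^+ 2)^-1)) x).
- by rewrite ltr_pdivrMr// mulr_natr mulr2n ltrDl t0 mulr_natl mulr2n ltrDl.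
- by rewrite !mulr_gt0.
- by move=> r _; exact: measurable_heatk.
- move=> r y /andP[r1 _]; apply: is_derive_heatk_time.
  by rewrite (lt_trans _ r1)// divr_gt0.
- move=> r y tr; have := h 1 0 r y ler01 (lexx 0) tr.
  rewrite mul0r addr0 mul1r; apply: le_trans.
  by rewrite gtr0_norm ?heatk_gt0.
move=> r y tr; have /andP[r1 r2] := tr.
have r0 : 0 < r by rewrite (lt_trans _ r1)// divr_gt0.
have nt0 : 0 <= n%:R / t by rewrite divr_ge0// ltW.
have := h (n%:R / t) (t ^+ 2)^-1 r y nt0 _ tr.
rewrite invr_ge0 sqr_ge0 => /(_ erefl); apply: le_trans.
rewrite normrM (ger0_norm (ltW (heatk_gt0 _ _ _))) ler_pM2r ?heatk_gt0//.
rewrite [leRHS]addrC (le_trans (ler_normB _ _))// lerD//.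
  have r2p : 0 < 4 * r ^+ 2 by rewrite mulr_gt0// exprn_gt0.
  rewrite ger0_norm; last by rewrite divr_ge0 ?sqn_ge0// ltW.
  rewrite mulrC; apply: ler_wpM2r; first exact: sqn_ge0.
  rewrite lef_pV2 ?posrE ?exprn_gt0//.
  have : t * t <= (2 * r) * (2 * r) by apply: ler_pM; lra.
  by rewrite !expr2; lra.
rewrite ger0_norm; last by rewrite divr_ge0// mulr_ge0// ltW.
apply: ler_wpM2l => //.
by rewrite lef_pV2 ?posrE ?mulr_gt0//; lra.
Qed.

Lemma second_derive_heatp t x i : 0 < t ->
  second_derive (fun s => heatp g t (x + s *: delta_mx 0 i))
  (\int[mu]_y (((x - y) 0 i ^+ 2 / (4 * t ^+ 2) - (2 * t)^-1) * heatk t x y * g y))%R.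
Proof.
move=> t0; have tn0 : t != 0 by rewrite gt_eqF.
pose c := hcst t.
have c0 : 0 < c := heat_cst_gt0 t.
pose F s y := c * gauss t (sqn (x - y) + 2 * (x - y) 0 i * s + s ^+ 2).
pose b y := (x - y) 0 i.
have FE s y : F s y = heatk t (x + s *: delta_mx 0 i) y by rewrite heatk_line.
have F0 s y : 0 < F s y by rewrite FE heatk_gt0.
(* For |s| < 1 the base point moves by at most 1, so [poly_gauss_shift] yields multiples of one
   Gaussian for the function and its first two derivatives. *)
have h (A B : R) s y : 0 <= A -> 0 <= B -> -1 < s < 1 ->
   (A + B * sqn (x + s *: delta_mx 0 i - y)) * F s y <=
   (c * ((A + 8 * t * B) * expR ((2 * t)^-1))) * gauss (4 * t) (sqn (x - y)).
  move=> A0 B0 /andP[s1 s2]; rewrite FE /heatk mulrCA -[leRHS]mulrA.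
  apply: ler_wpM2l; first exact: ltW.
  apply: poly_gauss_shift => //.
  rewrite (_ : _ - x = 0 + s *: delta_mx 0 i); last by rewrite addrAC subrr.
  rewrite sqn_shift mxE mulr0 mul0r addr0 (_ : sqn 0 = 0) ?add0r.
    by rewrite expr2 -[leRHS]mulr1; nra.
  by rewrite /sqn big1// => j _; rewrite mxE expr0n.
have bs s y : (b y + s) ^+ 2 <= sqn (x + s *: delta_mx 0 i - y).
  have := sqr_coord_le (x + s *: delta_mx 0 i - y) i.
  rewrite (_ : (_ - y) 0 i = b y + s)// /b !mxE !eqxx mulr1.
  exact: addrAC.
have mF s : measurable_fun setT (F s).
  rewrite (_ : F s = heatk t (x + s *: delta_mx 0 i)); first exact: measurable_heatk.
  by apply/funext => y; exact: FE.
have mb : measurable_fun setT b.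
  apply: (@measurable_continuous_rV R n b) => y.
  apply: (@continuous_comp _ _ _ (fun y => x - y) (fun z : 'rV[R]_n => z 0 i)).
    by apply: (@cvgB _ _ _ (nbhs y)); [exact: cvg_cst|exact: cvg_id].
  exact: coord_continuous.
have t4 : 0 < 4 * t by rewrite mulr_gt0.
have it0 : 0 <= (2 * t)^-1 by rewrite invr_ge0 mulr_ge0// ltW.
have i2t0 : 0 <= (4 * t ^+ 2)^-1 by rewrite invr_ge0 mulr_ge0// sqr_ge0.
have bF s y : -1 < s < 1 -> `|F s y| <=
    c * ((1 + 8 * t * 0) * expR ((2 * t)^-1)) * gauss (4 * t) (sqn (x - y)).
  move=> s1; have := h 1 0 s y ler01 (lexx 0) s1; rewrite mul0r addr0 mul1r.
  by apply: le_trans; rewrite gtr0_norm.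
have bF1 s y : -1 < s < 1 -> `|- ((b y + s) / (2 * t)) * F s y| <=
    c * (((2 * t)^-1 + 8 * t * (2 * t)^-1) * expR ((2 * t)^-1)) * gauss (4 * t) (sqn (x - y)).
  move=> s1; have := h (2 * t)^-1 (2 * t)^-1 s y it0 it0 s1; apply: le_trans.
  rewrite normrM (gtr0_norm (F0 _ _)) ler_pM2r// normrN normrM.
  rewrite -[X in _ <= X + _]mulr1 -mulrDr mulrC (ger0_norm it0) ler_wpM2l//.
  apply: le_trans (lerD (lexx 1) (bs s y)).
  rewrite -real_normK ?num_real//; have := normr_ge0 (b y + s).
  by move: `|_| => r; nra.
have bF2 s y : -1 < s < 1 ->
    `|((b y + s) ^+ 2 / (4 * t ^+ 2) - (2 * t)^-1) * F s y| <=
    c * (((2 * t)^-1 + 8 * t * (4 * t ^+ 2)^-1) * expR ((2 * t)^-1)) * gauss (4 * t) (sqn (x - y)).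
  move=> s1; have := h (2 * t)^-1 (4 * t ^+ 2)^-1 s y it0 i2t0 s1; apply: le_trans.
  rewrite normrM (gtr0_norm (F0 _ _)) ler_pM2r//.
  rewrite (le_trans (ler_normB _ _))// [leRHS]addrC lerD//; last by rewrite ger0_norm.
  rewrite ger0_norm; last exact: mulr_ge0 (sqr_ge0 _) i2t0.
  by rewrite mulrC; apply: ler_wpM2l => //; exact: bs.
exists (fun s => (\int[mu]_y (- ((b y + s) / (2 * t)) * F s y * g y))%R); split.
  near=> s.
  have s1 : -1 < s < 1.
    rewrite -ltr_norml; near: s; apply/nbhs_ballP; exists 1 => //= r.
    by rewrite /ball/= sub0r normrN.
  rewrite (_ : (fun s => _) = (fun s => (\int[mu]_y (F s y * g y))%R)); last first.
    by apply/funext => r; apply: eq_Rintegral => y _; rewrite FE.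
  apply: (is_derive_Rintegral (f := F)
    (df := fun s y => - ((b y + s) / (2 * t)) * F s y) s1 t4).
  - by move=> r _; exact: mF.
  - by move=> r y _; exact: is_derive_gauss_line.
  - exact: bF.
  - exact: bF1.
rewrite (_ : (\int[mu]_y _)%R =
  (\int[mu]_y (((b y + 0) ^+ 2 / (4 * t ^+ 2) - (2 * t)^-1) * F 0 y * g y))%R).
  have s1 : -1 < (0 : R) < 1 by rewrite ltrN10 ltr01.
  apply: (is_derive_Rintegral (f := fun s y => - ((b y + s) / (2 * t)) * F s y)
   (df := fun s y => ((b y + s) ^+ 2 / (4 * t ^+ 2) - (2 * t)^-1) * F s y) s1 t4).
  - move=> r _; apply: measurable_funM => //; apply: measurable_funN.
    by apply: measurable_funM => //; apply: measurable_funD.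
  - by move=> r y _; exact: is_derive2_gauss_line.
  - exact: bF1.
  - exact: bF2.
by apply: eq_Rintegral => y _; rewrite addr0 FE scale0r addr0.
Unshelve. all: by end_near. Qed.

End heat_potential.

Lemma Rintegral_sum {R : realType} d (Y : measurableType d)
    (mu : {measure set Y -> \bar R}) (I : Type) (r : seq I) (F : I -> Y -> R) :
  (forall i, mu.-integrable setT (EFin \o F i)) ->
  (\int[mu]_y (\sum_(i <- r) F i y))%R = \sum_(i <- r) (\int[mu]_y F i y)%R.
Proof.
move=> iF; elim: r => [|i r IH].
  rewrite big_nil; under eq_Rintegral do rewrite big_nil.
  by rewrite Rintegral_cst// mul0r.
rewrite big_cons -IH -RintegralD//.
  by apply: eq_Rintegral => y _; rewrite big_cons.
have := @integrable_sum _ _ _ mu setT measurableT I r xpredT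
  (fun i => EFin \o F i) (fun i _ => iF i).
by apply: eq_integrable => // y _; rewrite /= sumEFin.
Qed.

Lemma expR_inv_le {R : realType} (A B t : R) : 0 < B -> 0 < t ->
  expR (A - B / t) <= expR A * (t / B).
Proof.
move=> B0 t0; rewrite expRD ler_pM2l ?expR_gt0// expRN.
rewrite -[leRHS]invrK invf_div lef_pV2 ?posrE ?expR_gt0 ?divr_gt0//.
by rewrite (le_trans _ (expR_ge1Dx _))// lerDr.
Qed.

Section heat_potential_properties.
Context {R : realType} {n : nat}.
Implicit Types (x y : 'rV[R]_n) (t s : R).
Local Notation mu := (@lebesgue_rV R n).
Local Notation hcst := (@heat_cst R n).

Lemma heatk_continuous t x y : 0 < t ->
  heatk w.1 w.2 y @[w --> (t, x)] --> heatk t x y.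
Proof.
move=> t0; have pit : 0 < 4 * pi * t by rewrite !mulr_gt0// pi_gt0.
have c1 : (w : R * 'rV[R]_n).1 @[w --> (t, x)] --> t by exact: cvg_fst.
apply: cvgM.
  apply: (cvg_comp _ expR); last exact: continuous_expR.
  apply: cvgN; apply: cvgMl_tmp.
  apply: (cvg_comp _ (@ln R)); last exact: continuous_ln.
  by apply: cvgMl_tmp.
apply: (cvg_comp _ expR); last exact: continuous_expR.
apply: cvgN; apply: cvgM.
  apply: (cvg_comp _ sqn); last exact: sqn_continuous.
  by apply: cvgB; [exact: cvg_snd|exact: cvg_cst].
apply: cvgV; first by rewrite gt_eqF// mulr_gt0.
exact: cvgMl_tmp.
Qed.

Context (g : 'rV[R]_n -> R) (M : R) (mg : measurable_fun setT g)
  (g0 : forall y, 0 <= g y) (gM : forall y, g y <= M).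

(** The squared coordinates of x - y add up to [sqn (x - y)], so the two integrands agree for each
    y. *)
Lemma heatp_heat_equation t x : 0 < t -> exists (d : R) (D : 'I_n -> R),
  [/\ is_derive t (1 : R) (heatp g ^~ x) d,
      forall i, second_derive (fun s => heatp g t (x + s *: delta_mx 0 i)) (D i) &
      d = \sum_i D i].
Proof.
move=> t0; do 2 eexists; split.
- exact: is_derive_heatp_time.
- by move=> i; exact: (second_derive_heatp mg g0 gM).
rewrite -Rintegral_sum.
  apply: eq_Rintegral => y _; rewrite -!mulr_suml; congr (_ * _ * _).
  rewrite sumrB -mulr_suml sumr_const card_ord; congr (_ / _ - _).
  by rewrite -mulr_natl; field; rewrite gt_eqF.
move=> i; have i1 : 0 <= (2 * t)^-1 by rewrite invr_ge0 mulr_ge0// ltW.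
have i2 : 0 <= (4 * t ^+ 2)^-1 by rewrite invr_ge0 mulr_ge0// sqr_ge0.
apply: (@integrable_dominated_mul _ _ _ _ mg g0 gM
  (fun y => ((x - y) 0 i ^+ 2 / (4 * t ^+ 2) - (2 * t)^-1) * heatk t x y) (2 * t) x
  (hcst t * ((2 * t)^-1 + 8 * t * (4 * t ^+ 2)^-1))).
- by rewrite mulr_gt0.
- apply: measurable_funM; last exact: measurable_heatk.
  apply: measurable_funB => //; apply: measurable_funM => //.
  apply: (@measurable_continuous_rV R n (fun y => (x - y) 0 i ^+ 2)) => y.
  apply: (@continuous_comp _ _ _ (fun y => (x - y) 0 i) (fun r : R => r ^+ 2)).
    apply: (@continuous_comp _ _ _ (fun y => x - y) (fun z : 'rV[R]_n => z 0 i)).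
      by apply: (@cvgB _ _ _ (nbhs y)); [exact: cvg_cst|exact: cvg_id].
    exact: coord_continuous.
  exact: exprn_continuous.
move=> y; rewrite normrM (gtr0_norm (heatk_gt0 _ _ _)).
rewrite /heatk mulrCA -[leRHS]mulrA; apply: ler_wpM2l; first exact/ltW/heat_cst_gt0.
apply: le_trans (poly_gauss_le t0 i1 i2 (sqn_ge0 (x - y))).
apply: ler_wpM2r; first exact/ltW/gauss_gt0.
rewrite (le_trans (ler_normB _ _))// [leRHS]addrC lerD//; last by rewrite ger0_norm.
rewrite ger0_norm; last exact: mulr_ge0 (sqr_ge0 _) i2.
by rewrite mulrC; apply: ler_wpM2l => //; exact: sqr_coord_le.
Qed.

Lemma heatp_continuous t x : 0 < t ->
  heatp g w.1 w.2 @[w --> (t, x)] --> heatp g t x.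
Proof.
move=> t0.
pose C := hcst (t / 2) * expR ((2 * t)^-1) * M.
have t20 : 0 < t / 2 by rewrite divr_gt0.
apply: (@continuous_Rintegral R _ _ mu (R * 'rV[R]_n)%type
  (fun w y => heatk w.1 w.2 y * g y) (fun y => C * gauss (2 * (2 * t)) (sqn (x - y))) (t, x)).
- by move=> w; apply: measurable_funM => //; exact: measurable_heatk.
- by apply: integrable_gauss; rewrite !mulr_gt0.
- have n1 : \forall w \near (t, x), t / 2 < (w : R * 'rV[R]_n).1 < 2 * t.
    have c1 : (w : R * 'rV[R]_n).1 @[w --> (t, x)] --> t by exact: cvg_fst.
    near=> w; apply/andP; split; near: w.
      by apply: (cvgr_gt _ c1); rewrite ltr_pdivrMr// mulr_natr mulr2n ltrDl.
    by apply: (cvgr_lt _ c1); rewrite mulr_natl mulr2n ltrDl.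
  have n2 : \forall w \near (t, x), sqn ((w : R * 'rV[R]_n).2 - x) < 1.
    have c2 : sqn ((w : R * 'rV[R]_n).2 - x) @[w --> (t, x)] --> sqn (x - x).
      apply: (cvg_comp _ sqn); last exact: sqn_continuous.
      by apply: cvgB; [exact: cvg_snd|exact: cvg_cst].
    apply: (cvgr_lt _ c2); rewrite subrr /sqn big1// => i _.
    by rewrite mxE expr0n.
  apply: filterS2 n1 n2 => -[r z] /= /andP[r1 r2] zx y.
  have r0 : 0 < r := lt_trans t20 r1.
  rewrite normrM (ger0_norm (g0 y)) (gtr0_norm (heatk_gt0 _ _ _)).
  rewrite /C [leRHS]mulrAC ler_pM//; first exact/ltW/heatk_gt0.
  rewrite /heatk -[leRHS]mulrA ler_pM//.
  - exact/ltW/heat_cst_gt0.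
  - exact/ltW/gauss_gt0.
  - exact: heat_cst_le (ltW r1).
  have t2 : 0 < 2 * t by rewrite mulr_gt0.
  apply: le_trans (gauss_shift y t2 (ltW zx)).
  by apply: le_gauss (ltW r2) (sqn_ge0 _).
move=> y; apply: cvgM; last exact: cvg_cst.
exact: heatk_continuous.
Unshelve. all: by end_near. Qed.

(** For each y, [heatk t x y * g y] is at least [c * heatk t x y - c * ka * heatk (2 * t) x y]: near
    x because g y >= c, far from x because the tail bound makes the latter nonpositive. Both kernels
    have mass 1. This gives upper barriers their initial inequality. *)
Lemma heatp_initial_ge x0 (c e : R) : 0 <= c -> 0 < e ->
  (\forall y \near x0, c <= g y) ->
  \forall x \near x0 & t \near (0 : R)^'+, c - e <= heatp g t x.
Proof.
move=> c0 e0 /nbhs_ballP[rho /= rho0 Hrho].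
pose r := rho / 2; have r0 : 0 < r by rewrite divr_gt0.
pose k := expR (n%:R / 2 * ln 2 : R).
have k0 : 0 < k by exact: expR_gt0.
(* The time at which (c + 1) ka = e, where ka = k t / (r^2 / 8) bounds the tail factor; c itself may
   be 0. *)
pose tau := e * (r ^+ 2 / 8) / (k * (c + 1)).
have c1 : 0 < c + 1 by rewrite ltr_wpDl.
have tau0 : 0 < tau by rewrite divr_gt0// !mulr_gt0// exprn_gt0.
have nx : \forall x \near x0, `|x - x0| < r.
  apply/nbhs_ballP; exists r => //= x; rewrite -ball_normE /ball_/= => xx0.
  by rewrite distrC.
have nt : \forall t \near (0 : R)^'+, 0 < t < tau.
  near=> t; apply/andP; split; near: t; first exact: nbhs_right_gt.
  exact: nbhs_right_lt.
exists ([set x | `|x - x0| < r], [set t | 0 < t < tau]) => //= -[x t] /=.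
move=> [xr /andP[t0 tt]]; have t20 : 0 < 2 * t by rewrite mulr_gt0.
have r28 : 0 < r ^+ 2 / 8 by rewrite divr_gt0// exprn_gt0.
pose ka := k * (t / (r ^+ 2 / 8)).
have ka0 : 0 < ka by rewrite mulr_gt0// divr_gt0.
have cka : c * ka <= e.
  apply: (@le_trans _ _ ((c + 1) * ka)); first by rewrite ler_wpM2r ?ltW// ltrDl.
  rewrite (_ : (c + 1) * ka = t * (k * (c + 1)) / (r ^+ 2 / 8)); last first.
    by rewrite /ka; move: (r ^+ 2 / 8)^-1 => i; ring.
  by rewrite ler_pdivrMr// -ler_pdivlMr ?mulr_gt0// ltW.
pose L y := c * heatk t x y - (c * ka) * heatk (2 * t) x y.
have it := integrableZl measurableT c (integrable_heatk x t0).
have i2t := integrableZl measurableT (c * ka) (integrable_heatk x t20).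
have iL : mu.-integrable setT (EFin \o L).
  by have := integrableB measurableT it i2t; apply: eq_integrable.
have LE : (\int[mu]_y L y)%R = c - c * ka.
  rewrite RintegralB// RintegralZl//; last exact: integrable_heatk.
  rewrite RintegralZl//; last exact: integrable_heatk.
  by rewrite !Rintegral_heatk// !mulr1.
apply: (@le_trans _ _ (\int[mu]_y L y)%R); first by rewrite LE lerD2l lerN2.
apply: le_Rintegral => //; first exact: (integrable_heatk_mul mg g0 gM).
move=> y _; have [rxy|rxy] := lerP (r ^+ 2) (sqn (x - y)).
  apply: (@le_trans _ _ 0); last by rewrite mulr_ge0// ltW// heatk_gt0.
  rewrite subr_le0 -mulrA ler_wpM2l// (le_trans (heatk_tail t0 rxy))//.
  rewrite ler_pM2r ?heatk_gt0// invfM mulrA expR_inv_le//.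
apply: (@le_trans _ _ (c * heatk t x y)).
  rewrite gerBl; apply: mulr_ge0; first exact: mulr_ge0 c0 (ltW ka0).
  exact/ltW/heatk_gt0.
rewrite mulrC ler_pM2l ?heatk_gt0//; apply: Hrho.
rewrite -ball_normE /ball_/=.
have : `|x - y| < r.
  by rewrite (le_lt_trans (normr_le_enorm _))// enorm_lt.
move=> xy; rewrite (le_lt_trans (ler_distD x _ _))// [ltRHS]splitr ltrD//.
by rewrite distrC.
Unshelve. all: by end_near. Qed.

End heat_potential_properties.

(** * Decay of potentials of Morrey data *)

Section morrey_decay.
Context {R : realType} {n : nat}.
Implicit Types (x y : 'rV[R]_n) (t s : R).
Local Notation mu := (@lebesgue_rV R n).
Local Notation hcst := (@heat_cst R n).

Lemma measurable_eball x (r : R) : measurable (eball x r).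
Proof.
apply: measurable_open_rV; rewrite (_ : eball x r =
  (fun y => Num.sqrt (sqn (y - x))) @^-1` [set s | s < r])//.
apply: open_comp; last exact: open_lt.
move=> y _; apply: (@continuous_comp _ _ _ (fun y => sqn (y - x)) Num.sqrt).
  apply: (@continuous_comp _ _ _ (fun y => y - x) sqn); last exact: sqn_continuous.
  by apply: (@cvgB _ _ _ (nbhs y)); [exact: cvg_id|exact: cvg_cst].
exact: sqrt_continuous.
Qed.

Lemma expRN_le_pow (N : nat) (u : R) : (0 < N)%N -> 0 < u ->
  expR (- u) <= (N%:R / u) ^+ N.
Proof.
move=> N0 u0; have N0' : 0 < N%:R :> R by rewrite ltr0n.
rewrite expRN -[(N%:R / u) ^+ N]invrK lef_pV2 ?posrE ?expR_gt0 ?invr_gt0 ?exprn_gt0 ?divr_gt0//.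
have -> : expR u = expR (u / N%:R) ^+ N.
  by rewrite -expRM_natl mulrCA divff ?mulr1// gt_eqF.
rewrite -exprVn invf_div lerXn2r ?nnegrE ?expR_ge0 ?divr_ge0 ?(ltW u0) ?(ltW N0')//.
by rewrite (le_trans _ (expR_ge1Dx _))// lerDr.
Qed.

(** exp(-4^k / 4) is at most the power n + 1 of 4 (n + 1) / 4^k, hence at most this constant over
    2^((k+1)(n+1)). The power exceeds n, so that against the growth 2^(k n) of the mass of balls a
    summable factor 2^(-k) is left. *)
Definition shell_cst : R := (16 * n.+1%:R) ^+ n.+1.

Lemma shell_cst_gt0 : 0 < shell_cst.
Proof. by rewrite exprn_gt0// mulr_gt0. Qed.

(* Dyadic shells [2^(k-1) sqrt t <= |x - y| < 2^k sqrt t]. *)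
Lemma gauss_shell t x y : 0 < t -> exists k : nat,
  eball x (2 ^+ k * Num.sqrt t) y /\
  gauss t (sqn (x - y)) <= shell_cst / 2 ^+ (k * n.+1).
Proof.
move=> t0; set v := sqn (x - y).
have v0 : 0 <= v by exact: sqn_ge0.
have st0 : 0 < Num.sqrt t by rewrite sqrtr_gt0.
have ballE k : eball x (2 ^+ k * Num.sqrt t) y <-> v < 4 ^+ k * t.
  rewrite /eball/= enorm_lt ?mulr_gt0 ?exprn_gt0// sqnBC exprMn sqr_sqrtr ?ltW//.
  by rewrite -exprM mulnC exprM (_ : 2 ^+ 2 = 4 :> R)//; ring.
have ex : exists k, v < 4 ^+ k * t.
  have [N vN] : exists N : nat, v / t < N%:R.
    by exists (Num.bound (v / t)); rewrite archi_boundP// divr_ge0// ltW.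
  exists N; rewrite -ltr_pdivrMr// (lt_le_trans vN)//.
  by rewrite -natrX ler_nat ltnW// ltn_expl.
case: (ex_minnP ex) => k vk kmin; exists k; split; first exact/ballE.
case: k vk kmin => [|k] vk kmin.
  rewrite mul0n expr0 divr1 (@le_trans _ _ 1)//.
    by rewrite -[leRHS]expR0 ler_expR oppr_le0 divr_ge0// mulr_ge0// ltW.
  by rewrite exprn_ege1// -natrM ler1n.
have kv : 4 ^+ k * t <= v by rewrite leNgt; apply/negP => /kmin; rewrite ltnn.
apply: (@le_trans _ _ (expR (- (4 ^+ k / 4)))).
  rewrite ler_expR lerN2 ler_pdivlMr ?mulr_gt0//.
  by rewrite (_ : _ / 4 * (4 * t) = 4 ^+ k * t)//; field.
have u0 : 0 < 4 ^+ k / 4 :> R by rewrite divr_gt0// exprn_gt0.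
rewrite (le_trans (expRN_le_pow (ltn0Sn n) u0))// /shell_cst exprM -expr_div_n.
rewrite lerXn2r ?nnegrE ?divr_ge0 ?mulr_ge0 ?exprn_ge0//.
rewrite invf_div (mulrC 16) -[leRHS]mulrA; apply: ler_wpM2l => //.
rewrite ler_pdivrMr ?exprn_gt0// mulrAC ler_pdivlMr ?exprn_gt0// exprS.
have : 2 ^+ k <= 4 ^+ k :> R by rewrite lerXn2r ?nnegrE// ler_nat.
have : 0 <= 4 ^+ k :> R by rewrite exprn_ge0.
lra.
Qed.

Lemma sum_geometric_half (N : nat) (c : R) : 0 <= c ->
  \sum_(0 <= k < N) c / 2 ^+ k <= 2 * c.
Proof.
move=> c0; suff -> : \sum_(0 <= k < N) c / 2 ^+ k = 2 * c - 2 * c / 2 ^+ N.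
  by rewrite gerBl divr_ge0 ?mulr_ge0 ?exprn_ge0.
elim: N => [|N IH]; first by rewrite big_geq// expr0 divr1 subrr.
rewrite big_nat_recr//= IH exprS; field.
by rewrite expf_neq0.
Qed.

Lemma heat_cst_powR t (l : R) : 0 < t ->
  hcst t * t `^ ((n%:R - l) / 2) = hcst 1 * t `^ (- (l / 2)).
Proof.
move=> t0; rewrite /heat_cst /powR gt_eqF// -!expRD; congr expR.
rewrite mulr1 lnM ?posrE ?mulr_gt0 ?pi_gt0//.
by field.
Qed.

(** Each y lies in some ball of radius 2^k sqrt t on which the kernel at y is at most [a k]. The
    mass of g in that ball is at most m (2^k sqrt t)^(n - l), and l >= 0 makes the product at most c
    2^(-k), with sum 2 c. *)
Lemma heatp_morrey (g : 'rV[R]_n -> R) x (l t m : R) :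
  measurable_fun setT g -> (forall y, 0 <= g y) ->
  0 <= l <= n%:R -> 0 < t -> 0 <= m ->
  (forall r, 0 < r ->
    (\int[mu]_(y in eball x r) (g y)%:E <= (m * r `^ (n%:R - l))%:E)%E) ->
  heatp g t x <= 2 * (hcst 1 * shell_cst) * m * t `^ (- (l / 2)).
Proof.
move=> mg g0 /andP[l0 ln] t0 m0 gm.
have st0 : 0 < Num.sqrt t by rewrite sqrtr_gt0.
pose B k := eball x (2 ^+ k * Num.sqrt t).
pose a k := hcst t * (shell_cst / 2 ^+ (k * n.+1)).
have a0 k : 0 <= a k.
  apply: mulr_ge0; first exact/ltW/heat_cst_gt0.
  by rewrite divr_ge0 ?exprn_ge0// ltW// shell_cst_gt0.
pose u k y : \bar R := ((a k)%:E * (g y * \1_(B k) y)%:E)%E.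
have gB0 k y : 0 <= g y * \1_(B k) y by rewrite mulr_ge0// indicE.
have u0 k y : (0 <= u k y)%E by rewrite /u -EFinM lee_fin mulr_ge0.
have mgB k : measurable_fun setT (fun y => g y * \1_(B k) y).
  apply: measurable_funM => //; apply: measurable_indic; exact: measurable_eball.
have mu_ k : measurable_fun setT (u k).
  by apply: emeasurable_funM => //; exact/measurable_EFinP.
pose c := hcst 1 * shell_cst * m * t `^ (- (l / 2)).
have c0 : 0 <= c.
  rewrite !mulr_ge0 ?powR_ge0//; first exact/ltW/heat_cst_gt0.
  exact/ltW/shell_cst_gt0.
have iu k : (\int[mu]_y u k y <= (c / 2 ^+ k)%:E)%E.
  rewrite ge0_integralZl//; last 3 first.
  - exact/measurable_EFinP.
  - by move=> y _; rewrite lee_fin.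
  - by rewrite lee_fin.
  have -> : (\int[mu]_y (g y * \1_(B k) y)%:E = \int[mu]_(y in B k) (g y)%:E)%E.
    rewrite [RHS]integral_mkcond; apply: eq_integral => y _.
    by rewrite patchE indicE; case: ifP; rewrite ?mulr1 ?mulr0.
  have r0 : 0 < 2 ^+ k * Num.sqrt t by rewrite mulr_gt0// exprn_gt0.
  apply: le_trans (lee_wpmul2l _ (gm _ r0)) _; first by rewrite lee_fin.
  rewrite -EFinM lee_fin powRM ?exprn_ge0 ?(ltW st0)//.
  have -> : Num.sqrt t `^ (n%:R - l) = t `^ ((n%:R - l) / 2).
    by rewrite -powR12_sqrt ?ltW// -powRrM mulrC.
  have p2 : (2 ^+ k) `^ (n%:R - l) <= 2 ^+ (k * n) :> R.
    rewrite exprM -[leRHS]powR_mulrn ?exprn_ge0//; apply: ler_powR.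
      by rewrite exprn_ege1// ler1n.
    by rewrite gerBl.
  have -> : c = shell_cst * m * (hcst t * t `^ ((n%:R - l) / 2)).
    by rewrite heat_cst_powR// /c; ring.
  rewrite (_ : a k * _ = shell_cst * m * (hcst t * t `^ ((n%:R - l) / 2)) *
      ((2 ^+ k) `^ (n%:R - l) / 2 ^+ (k * n.+1))); last by rewrite /a; ring.
  apply: ler_wpM2l.
    rewrite !mulr_ge0 ?powR_ge0//; first exact/ltW/shell_cst_gt0.
    exact/ltW/heat_cst_gt0.
  rewrite mulnS exprD ler_pdivrMr ?mulr_gt0 ?exprn_gt0// mulrA mulVf ?mul1r//.
have key : (\int[mu]_y (heatk t x y * g y)%:E <= (2 * c)%:E)%E.
  apply: (@le_trans _ _ (\int[mu]_y (\sum_(k <oo) u k y))%E).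
    apply: ge0_le_integral => //.
    - by move=> y _; rewrite lee_fin mulr_ge0// ltW// heatk_gt0.
    - apply/measurable_EFinP/measurable_funM => //; exact: measurable_heatk.
    - exact: ge0_emeasurable_sum.
    move=> y _; have [k [Bk gk]] := gauss_shell x y t0.
    apply: le_trans (nneseries_lim_ge k.+1 _); last by [].
    rewrite big_nat_recr//= -[leLHS]add0e leeD ?sume_ge0//.
    rewrite /u indicE mem_set// mulr1 -EFinM lee_fin ler_wpM2r//.
    rewrite /heatk ler_pM2l ?heat_cst_gt0//.
  rewrite integral_nneseries//.
  apply: lime_le; first by apply: is_cvg_nneseries => k _ _; exact: integral_ge0.
  apply: nearW => N; apply: (@le_trans _ _ (\sum_(0 <= k < N) (c / 2 ^+ k)%:E)%E).
    by apply: lee_sum => k _; exact: iu.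
  by rewrite sumEFin lee_fin sum_geometric_half.
rewrite (_ : _ * _ * m * _ = 2 * c); last by rewrite /c; ring.
have fin : (\int[mu]_y (heatk t x y * g y)%:E)%E \is a fin_num.
  rewrite ge0_fin_numE; first exact: le_lt_trans key (ltry _).
  by apply: integral_ge0 => y _; rewrite lee_fin mulr_ge0// ltW// heatk_gt0.
by rewrite -lee_fin fineK.
Qed.

End morrey_decay.

(** * Comparison principles *)

Section powers.
Context {R : realType}.
Implicit Types y P th q : R.

(** Concavity of the power, from Young's inequality for y^th and P^(1 - th) with exponents 1/th and
    1/(1 - th), multiplied by P^(th - 1). For th = 1 these exponents degenerate and equality
    holds. *)
Lemma powR_tangent y P th : 0 <= y -> 0 < P -> 0 < th <= 1 ->
  y `^ th <= th * P `^ (th - 1) * y + (1 - th) * P `^ th.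
Proof.
move=> y0 P0 /andP[th0]; rewrite le_eqVlt => /predU1P[->|th1].
  by rewrite subrr powRr0 powRr1// mul0r addr0 !mul1r.
have q0 : 0 < (1 - th)^-1 by rewrite invr_gt0 subr_gt0.
have := @conjugate_powR R (y `^ th) (P `^ (1 - th)) th^-1 (1 - th)^-1
  (powR_ge0 _ _) (powR_ge0 _ _).
rewrite invr_gt0 => /(_ th0 q0); rewrite !invrK => /(_ _)/wrap[|].
  by rewrite addrC subrK.
rewrite -!powRrM !mulfV ?gt_eqF ?subr_gt0// !powRr1 ?(ltW P0)// => h.
have Pth : P `^ (1 - th) * P `^ (th - 1) = 1.
  by rewrite -powRD ?(gt_eqF P0) ?implybT// (_ : _ + _ = 0) ?powRr0//; ring.
have Pth' : P * P `^ (th - 1) = P `^ th.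
  rewrite -{1}[P]powRr1 ?(ltW P0)// -powRD ?(gt_eqF P0) ?implybT//.
  by congr powR; ring.
have : y `^ th * P `^ (1 - th) * P `^ (th - 1) <=
    (y * th + P * (1 - th)) * P `^ (th - 1) by rewrite ler_wpM2r ?powR_ge0.
rewrite -mulrA Pth mulr1 => /le_trans; apply.
by rewrite mulrDl -Pth'; lra.
Qed.

Lemma powR_tangent_eq P th : 0 < P ->
  th * P `^ (th - 1) * P + (1 - th) * P `^ th = P `^ th.
Proof.
move=> P0; have -> : th * P `^ (th - 1) * P = th * P `^ th.
  rewrite -mulrA; congr (_ * _); rewrite -{2}[P]powRr1 ?(ltW P0)//.
  by rewrite -powRD ?(gt_eqF P0) ?implybT//; congr powR; ring.
by ring.
Qed.

(** Convexity of the power q at A, read off from the tangent at A^q to the concave power 1/q. It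
    serves both for q-th powers of heat flows and for increments of the nonlinearity. *)
Lemma powR_sub_le q A B : 1 < q -> 0 <= B -> B <= A ->
  A `^ q <= B `^ q + q * A `^ (q - 1) * (A - B).
Proof.
move=> q1 B0 BA; have [A0|A0] := eqVneq A 0.
  have -> : B = 0 by apply/le_anti; rewrite B0 -A0 BA.
  by rewrite A0 subrr mulr0 addr0.
have {}A0 : 0 < A by rewrite lt_neqAle eq_sym A0 (le_trans B0 BA).
have q0 : 0 < q by apply: lt_trans q1.
have /(powR_tangent (powR_ge0 B q) (powR_gt0 q A0)) : 0 < q^-1 <= 1.
  by rewrite invr_gt0 q0 invf_le1// ltW.
rewrite -!powRrM mulfV ?gt_eqF// !powRr1 ?(ltW A0)//.
rewrite (_ : q * (q^-1 - 1) = 1 - q); last by field; rewrite gt_eqF.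
move=> h.
have E1 : A `^ (1 - q) * A `^ (q - 1) = 1.
  by rewrite -powRD ?(gt_eqF A0) ?implybT// (_ : _ + _ = 0) ?powRr0//; ring.
have E2 : A * A `^ (q - 1) = A `^ q.
  rewrite -{1}[A]powRr1 ?(ltW A0)// -powRD ?(gt_eqF A0) ?implybT//.
  by congr powR; ring.
have : q * A `^ (q - 1) * B <= q * A `^ (q - 1) *
   (q^-1 * A `^ (1 - q) * B `^ q + (1 - q^-1) * A).
  by rewrite ler_wpM2l// mulr_ge0 ?powR_ge0// ltW.
rewrite (_ : q * A `^ (q - 1) * (_ + _) =
   (A `^ (1 - q) * A `^ (q - 1)) * B `^ q + (q - 1) * (A * A `^ (q - 1))).
  by rewrite E1 E2 mulrBr -[q * _ * A]mulrA [_ * A]mulrC E2; lra.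
by field; rewrite gt_eqF.
Qed.

End powers.

(** * Classical solutions seen along coordinate lines *)

Section classical_data.
Context {R : realType} {n : nat}.
Implicit Types (x y : 'rV[R]_n) (Omega : set 'rV[R]_n) (u h : R -> 'rV[R]_n -> R).

(** The form in which the maximum principle consumes a classical solution: continuity up to the
    lateral boundary and derivatives at one point at a time. It passes easily to -u, which gives
    two-sided bounds. *)
Definition classical_data Omega (T : \bar R) h u : Prop :=
  [/\ {within cylinder (closure Omega) T, continuous (fun z => u z.1 z.2)},
      forall t x, cylinder Omega T (t, x) -> exists (d : R) (D : 'I_n -> R),
        [/\ is_derive t (1 : R) (u^~ x) d,
            forall i, second_derive (fun s => u t (x + s *: delta_mx 0 i)) (D i) &
            d - \sum_i D i = h t x] &
      forall t x, cylinder (boundary Omega) T (t, x) -> u t x = 0].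

Lemma is_derive_line (f : 'rV[R]_n -> R) x v (s : R) :
  derivable f (x + s *: v) v ->
  is_derive s (1 : R) (fun r => f (x + r *: v)) ('D_v f (x + s *: v)).
Proof.
move=> df.
have E : (fun h : R => h^-1 *: (f (x + (h *: (1 : R) + s) *: v) - f (x + s *: v))) =
    (fun h : R => h^-1 *: (f (h *: v + (x + s *: v)) - f (x + s *: v))).
  apply/funext => h; congr (_ *: (f _ - _)).
  by rewrite scalerDl [h *: 1]mulr1 addrCA.
by apply: DeriveDef; rewrite /derivable /derive /= E.
Qed.

Lemma dirichlet_classical_data Omega (T : \bar R) h u : open Omega ->
  dirichlet_solution Omega T h u -> classical_data Omega T h u.
Proof.
move=> oO [[cu [ut cut] ux uxx] wu eq bd]; split => // t x tx.
exists (derive1 (u^~ x) t), (fun i => partial i (partial i (u t)) x); split.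
- by rewrite derive1E; apply: derivableP; exact: ut.
- move=> i; exists (fun s => partial i (u t) (x + s *: delta_mx 0 i)); split.
    have [_ _ Ox] := tx; have := near_line i oO Ox; apply: filterS => s Os.
    apply: is_derive_line; have [+ _] := ux i; apply.
    by case: tx.
  have [+ _] := uxx i i => /(_ t x tx) dxx.
  apply: is_derive_eq (is_derive_line _) _; rewrite scale0r addr0//.
- exact: eq.
Qed.

Lemma classical_data_opp Omega (T : \bar R) h u : classical_data Omega T h u ->
  classical_data Omega T (fun t x => - h t x) (fun t x => - u t x).
Proof.
move=> [wu eq bd]; split.
- by move=> w; have := continuousN (wu w).
- move=> t x tx; have [d [D [ud uD dD]]] := eq _ _ tx.
  exists (- d), (fun i => - D i); split; last by rewrite sumrN -dD; ring.
    exact: is_deriveN.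
  move=> i; apply: second_derive_eq (second_derive_linear (-1) 0 (uD i) (uD i)) => [s|].
    by rewrite mul0r addr0 mulN1r.
  by rewrite mul0r addr0 mulN1r.
by move=> t x tx; rewrite bd// oppr0.
Qed.

Lemma classical_data_near Omega (T : \bar R) h u t x0 e : classical_data Omega T h u ->
  cylinder (closure Omega) T (t, x0) -> 0 < e ->
  \forall w \near (t, x0), cylinder (closure Omega) T w ->
    `|u w.1 w.2 - u t x0| < e.
Proof.
move=> [/subspace_continuousP wu _ _] tx e0.
have /cvgrPdist_lt /(_ _ e0) := wu _ tx.
rewrite near_withinE; apply: filterS => w + /[dup] cw => /[apply].
by rewrite distrC.
Qed.

Lemma classical_data_slice Omega (T : \bar R) h u t x : open Omega ->
  classical_data Omega T h u -> cylinder Omega T (t, x) ->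
  {for x, continuous (u t)}.
Proof.
move=> oO cu [/= t0 tT Ox]; apply/(@cvgrPdist_lt _ _ _ (nbhs x)) => e e0.
have ctx : cylinder (closure Omega) T (t, x) by split => //; exact: subset_closure.
have [[A B]/= [At Bx] AB] := classical_data_near cu ctx e0.
have nO : nbhs x Omega by exact: open_nbhs_nbhs.
apply: filterS2 nO Bx => y Oy By; rewrite distrC; apply: (AB (t, y)).
  by split => //; exact: nbhs_singleton At.
by split => //; exact: subset_closure.
Qed.

End classical_data.

(** * Comparison of heat flows with affine functions of a Gaussian potential *)

Section comparison.
Context {R : realType} {n : nat}.
Implicit Types (x y : 'rV[R]_n) (Omega : set 'rV[R]_n).

(** Affine functions of [heatp g] solve the heat equation, so only the derivative of the factor
    s^gam survives. One computation serves both comparisons; the linear one takes c = 0. *)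
Lemma derivatives_sub_heatp (g : 'rV[R]_n -> R) (M : R) (U : R -> 'rV[R]_n -> R)
    (t d0 h a b c gam a' b' : R) (D0 : 'I_n -> R) x :
  measurable_fun setT g -> (forall y, 0 <= g y) -> (forall y, g y <= M) ->
  0 < t -> is_derive t (1 : R) (U^~ x) d0 ->
  (forall i, second_derive (fun s => U t (x + s *: delta_mx 0 i)) (D0 i)) ->
  d0 - \sum_i D0 i = h ->
  let zeta s y := U s y -
    (a * heatp g s y + b + c * s `^ gam * (a' * heatp g s y + b')) in
  exists (d : R) (D : 'I_n -> R), [/\ is_derive t (1 : R) (zeta^~ x) d,
    forall i, second_derive (fun s => zeta t (x + s *: delta_mx 0 i)) (D i) &
    d - \sum_i D i = h - c * gam * t `^ (gam - 1) * (a' * heatp g t x + b')].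
Proof.
move=> mg g0 gM t0 Ud UD <- zeta.
have [dp [Dp [pd pD dpE]]] := heatp_heat_equation mg g0 gM x t0.
pose k := a + c * t `^ gam * a'.
exists (d0 - (k * dp + c * gam * t `^ (gam - 1) * (a' * heatp g t x + b'))),
  (fun i => D0 i - k * Dp i); split.
- have dw := is_derive1_powR gam t0.
  have d1 := is_deriveD (is_deriveZ a pd) (is_derive_cst b t (1 : R)).
  have d2 := is_deriveD (is_deriveZ a' pd) (is_derive_cst b' t (1 : R)).
  apply: is_derive_eq (is_deriveB Ud (is_deriveD d1 (is_deriveM (is_deriveZ c dw) d2))) _.
  by rewrite /k !fctE /= /GRing.scale /=; ring.
- move=> i.
  apply: second_derive_eq (second_derive_linear 1 1
    (second_derive_linear 1 (- k) (UD i) (pD i))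
    (second_derive_cst (- (b + c * t `^ gam * b')))) => [s|].
    by rewrite /zeta /k /=; ring.
  by ring.
by rewrite sumrB -mulr_sumr -dpE; ring.
Qed.

Context (Omega : set 'rV[R]_n) (oO : open Omega).

(** As [v tau] is continuous, the initial inequality can be checked pointwise: |v| <= a |v|^q + b,
    and for small times the potential of |v tau|^q almost reaches its data from below. Both sides
    solve the heat equation, so the maximum principle applies with K = 0. *)
Lemma linear_comparison (v : R -> 'rV[R]_n -> R) (M a b q tau : R) :
  0 < q -> classical_data Omega +oo (fun _ _ => 0) v ->
  (forall t x, 0 < t -> Omega x -> `|v t x| <= M) ->
  0 <= a -> 0 <= b -> (forall y : R, 0 <= y -> y <= a * y `^ q + b) ->
  0 < tau -> forall t x, 0 < t -> Omega x ->
  v (tau + t) x <= a * heatp ((fun y => `|v tau y| `^ q) \_ Omega) t x + b.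
Proof.
move=> q0 cv vM a0 b0 ab tau0 T x1 T0 Ox1.
set h := (fun y => `|v tau y| `^ q) \_ Omega.
have h0 y : 0 <= h y by rewrite /h patchE; case: ifP => // _; exact: powR_ge0.
have hM y : h y <= M `^ q.
  rewrite /h patchE; case: ifP => [|_]; last exact: powR_ge0.
  rewrite inE => Oy; have vy := vM _ _ tau0 Oy.
  by apply: ge0_ler_powR; rewrite ?nnegrE ?(ltW q0)// (le_trans _ vy).
have ctau y : Omega y -> cylinder Omega +oo (tau, y) by move=> Oy; split => //=; exact: ltry.
have cv_tau y : Omega y -> {for y, continuous (v tau)}.
  by move=> Oy; apply: classical_data_slice cv (ctau y Oy).
have mh : measurable_fun setT h.
  apply/(measurable_restrictT _ _).1; first exact: measurable_open_rV.
  apply: (@measurableT_comp _ _ _ _ _ _ (@powR R ^~ q)); first exact: measurable_powR.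
  apply: measurableT_comp => //.
  exact: measurable_fun_open_rV.
pose z s x := v (tau + s) x - (a * heatp h s x + b).
have hp0 s x : 0 <= a * heatp h s x + b.
  by rewrite addr_ge0// mulr_ge0//; exact: heatp_ge0.
suff : z T x1 <= 0 by rewrite /z subr_le0.
apply: (@maximum_principle R n Omega T 0 M z oO) => //.
- apply: within_continuousB.
    apply/subspace_continuousP => -[s x] /= [/andP[s0 sT] cx].
    apply/cvgrPdist_lt => e e0.
    have cx' : cylinder (closure Omega) +oo (tau + s, x).
      by split => //=; [exact: addr_gt0|exact: ltry].
    have [[A B]/= [As Bx] AB] := classical_data_near cv cx' e0.
    rewrite near_withinE; exists ((fun r => A (tau + r)), B) => /=.
      split=> //; have sh : tau + r @[r --> s] --> tau + s.
        by apply: cvgD; [exact: cvg_cst|exact: cvg_id].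
      exact: sh _ As.
    move=> [r y] /= [Ar By] [/andP[r0 rT] cy].
    rewrite distrC; apply: (AB (tau + r, y)) => //; split => //=.
      exact: addr_gt0.
    exact: ltry.
  move=> w.
  apply: (@continuous_in_subspaceT _ _ _ (fun w : R * 'rV[R]_n => a * heatp h w.1 w.2 + b)).
  move=> -[s x]; rewrite inE /= => -[/andP[s0 _] _].
  apply: cvgD; last exact: cvg_cst.
  by apply: cvgMl_tmp; exact: (heatp_continuous mh h0 hM).
- move=> s x /andP[s0 _] Ox; rewrite lerBlDr (le_trans (ler_norm _))//.
  by rewrite (le_trans (vM _ _ _ Ox)) ?addr_gt0// lerDl.
- move=> s x /andP[s0 _] bx; have [_ _ bd] := cv.
  rewrite /z bd ?sub0r ?oppr_le0//; split => //=; [exact: addr_gt0|exact: ltry].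
- move=> x0 cx0 e e0.
  have e2 : 0 < e / 2 by rewrite divr_gt0.
  have cx' : cylinder (closure Omega) +oo (tau, x0) by split => //=; exact: ltry.
  have [[A B]/= [At Bx] AB] := classical_data_near cv cx' e2.
  have nA : \forall s \near (0 : R)^'+, A (tau + s).
    have sh : tau + s @[s --> (0 : R)] --> tau.
      by rewrite -[X in _ --> X]addr0; apply: cvgD; [exact: cvg_cst|exact: cvg_id].
    exact: cvg_at_right_filter sh _ At.
  have vnear : \forall x \near x0 & s \near (0 : R)^'+, Omega x ->
      v (tau + s) x <= v tau x0 + e / 2.
    exists (B, (fun s => A (tau + s)) `&` [set s | 0 < s]).
      split => //=; apply: filterI => //; exact: nbhs_right_gt.
    move=> [x s] /= [Bxx [As s0]] Ox.
    have cs : cylinder (closure Omega) +oo (tau + s, x).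
      split => //=; [exact: addr_gt0|exact: ltry|exact: subset_closure].
    have /= := AB (tau + s, x) (conj As Bxx) cs.
    by rewrite ltr_distl => /andP[_ /ltW].
  (* At a boundary point [v tau] vanishes, and a nonnegative barrier suffices. *)
  have [Ox0|nOx0] := pselect (Omega x0); last first.
    have [_ _ bd] := cv.
    have v0 : v tau x0 = 0.
      apply: bd; split => //=; first exact: ltry.
      by split => // /interior_subset.
    apply: filterS vnear => -[x s] /= xs /xs; rewrite v0 add0r => vxs.
    rewrite /z; have := hp0 s x; lra.
  (* Two losses of e', one in the bound of h near x0 and one in its potential, must cost a (2 e') <=
     e / 2; here a may be 0. *)
  pose e' := e / (4 * (a + 1)).
  have a1 : 0 < a + 1 by rewrite ltr_wpDl.
  have e'0 : 0 < e' by rewrite divr_gt0// mulr_gt0.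
  pose c := Num.max (`|v tau x0| `^ q - e') 0.
  have c0 : 0 <= c by rewrite le_max lexx orbT.
  have hc : \forall y \near x0, c <= h y.
    have [v0|v0] := eqVneq (v tau x0) 0.
      near=> y; rewrite /c v0 normr0 powR0 ?gt_eqF// sub0r.
      by rewrite (max_idPr _) ?oppr_le0// ltW.
    have nO : nbhs x0 Omega by exact: open_nbhs_nbhs.
    have cp : {for x0, continuous (fun y => `|v tau y| `^ q)}.
      apply: (@continuous_comp _ _ _ (fun y => `|v tau y|) (@powR R ^~ q)).
        apply: (@continuous_comp _ _ _ (v tau) Num.norm); first exact: cv_tau.
        exact: norm_continuous.
      have vp : 0 < `|v tau x0| by rewrite normr_gt0.
      apply: differentiable_continuous; apply/derivable1_diffP.
      by have [] := is_derive1_powR q vp.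
    have : \forall y \near x0, `|v tau x0| `^ q - e' < `|v tau y| `^ q.
      by apply: (@cvgr_gt _ _ (nbhs x0) _ _ _ cp); rewrite gtrBl.
    apply: (@filterS2 _ (nbhs x0) _ _ _ _ _ nO) => y Oy vy.
    by rewrite /h patchE mem_set// ge_max powR_ge0 (ltW vy).
  have pnear := heatp_initial_ge mh h0 hM c0 e'0 hc.
  apply: filterS2 vnear pnear => -[x s] /= xs ps Ox.
  have := xs Ox; rewrite /z => vxs.
  have cc : `|v tau x0| `^ q - e' <= c by rewrite le_max lexx.
  have ap : a * (`|v tau x0| `^ q - 2 * e') <= a * heatp h s x.
    by rewrite ler_wpM2l//; lra.
  have := ab _ (normr_ge0 (v tau x0)); have := ler_norm (v tau x0).
  have : a * (2 * e') <= e / 2.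
    rewrite /e' invfM !mulrA ler_pdivrMr//.
    have : 0 <= a * e by rewrite mulr_ge0// ltW.
    lra.
  lra.
move=> s x /andP[s0 sT] Ox zp.
have [_ eq _] := cv.
have ctx : cylinder Omega +oo (tau + s, x) by split => //=; [exact: addr_gt0|exact: ltry].
have [d0 [D0 [vd vD dD]]] := eq _ _ ctx.
pose V s x := v (tau + s) x.
have vd' : is_derive s (1 : R) (V^~ x) d0.
  have dsh : is_derive s (1 : R) (fun s => tau + s) 1.
    apply: is_derive_eq (is_deriveD (is_derive_cst tau s (1 : R))
      (is_derive_id s (1 : R))) _.
    by rewrite add0r.
  by apply: is_derive_eq (is_derive1_comp vd dsh) _; rewrite mulr1.
have [d [D [zd zD dDE]]] := @derivatives_sub_heatp h (M `^ q) V s d0 0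
  a b 0 1 0 0 D0 x mh h0 hM s0 vd' vD dD.
exists (fun s x => V s x - (a * heatp h s x + b + 0 * s `^ 1 * (0 * heatp h s x + 0))), d, D.
split.
- by rewrite /z !mul0r addr0.
- by move=> r y _ _; rewrite -[0 * _ * _]mulrA mul0r addr0; exact: lexx.
- exact: zd.
- exact: zD.
by rewrite dDE !mul0r subr0.
by rewrite T0 lexx.
Unshelve. all: by end_near. Qed.

End comparison.

(** * Domination of the Dirichlet heat flow by a Gaussian potential *)

Section heat_flow_bound.
Context {R : realType} {n : nat}.
Implicit Types (x y : 'rV[R]_n) (Omega : set 'rV[R]_n).
Local Notation mu := (@lebesgue_rV R n).
Local Notation hcst := (@heat_cst R n).

(** Data in L^oo are only essentially bounded; the cut at M provides the pointwise bound under which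
    potentials are differentiated. Extension by 0 lets the whole-space kernel act. *)
Definition power_data Omega (f : 'rV[R]_n -> R) (q M : R) : 'rV[R]_n -> R :=
  (fun y => Num.min `|f y| M `^ q) \_ Omega.

Section power_data.
Context (Omega : set 'rV[R]_n) (f : 'rV[R]_n -> R) (q M : R).

Lemma power_data_ge0 y : 0 <= power_data Omega f q M y.
Proof. by rewrite /power_data patchE; case: ifP => // _; exact: powR_ge0. Qed.

Lemma power_data_le y : 0 <= q -> 0 <= M -> power_data Omega f q M y <= M `^ q.
Proof.
move=> q0 M0; rewrite /power_data patchE; case: ifP => _; last exact: powR_ge0.
by apply: ge0_ler_powR; rewrite ?nnegrE ?le_min ?normr_ge0// ge_min lexx orbT.
Qed.

Lemma measurable_powR_restrict (h : 'rV[R]_n -> R) : open Omega ->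
  measurable_fun Omega h -> measurable_fun setT ((fun y => h y `^ q) \_ Omega).
Proof.
move=> oO mh; apply/(measurable_restrictT _ _).1; first exact: measurable_open_rV.
by apply: (@measurableT_comp _ _ _ _ _ _ (@powR R ^~ q)); first exact: measurable_powR.
Qed.

Lemma measurable_power_data : open Omega -> measurable_fun Omega f ->
  measurable_fun setT (power_data Omega f q M).
Proof.
move=> oO mf; apply: measurable_powR_restrict => //.
by apply: measurable_minr => //; exact: measurableT_comp.
Qed.

End power_data.

(** For |y| < r the excess of |w|^q over the truncated data is at most q M^(q-1) |w - f|, which is
    small in L^1; for |y| >= r the bound M^q meets the tail of the kernel. *)
Lemma heatp_near_initial Omega (f : 'rV[R]_n -> R) (w : R -> 'rV[R]_n -> R)
    (M q t e : R) x :
  open Omega -> measurable_fun Omega f ->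
  (forall s, 0 < s -> measurable_fun Omega (w s)) -> 1 < q -> 0 <= M ->
  (forall s y, 0 < s -> Omega y -> `|w s y| <= M) ->
  (forall r : R, 0 < r ->
     (\int[mu]_(y in eball 0 r `&` Omega) `|w s y - f y|%:E)%E
        @[s --> 0^'+] --> 0%E) ->
  0 < t -> 0 < e ->
  \forall s \near (0 : R)^'+, heatp ((fun y => `|w s y| `^ q) \_ Omega) t x <=
    heatp (power_data Omega f q M) t x + e.
Proof.
move=> oO mf mw q1 M0 wM wf t0 e0.
have q0 : 0 < q by apply: lt_trans q1.
set g := power_data Omega f q M.
have mg : measurable_fun setT g by exact: measurable_power_data.
have g0 y : 0 <= g y by exact: power_data_ge0.
have gM y : g y <= M `^ q by apply: power_data_le => //; exact: ltW.
pose k := expR (n%:R / 2 * ln 2 : R).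
have k0 : 0 < k by exact: expR_gt0.
have Mq0 : 0 <= M `^ q by exact: powR_ge0.
(* Makes the tail contribution M^q k t / B at most e / 2; the added 1 keeps B positive if M = 0. *)
pose B := 2 * M `^ q * k * t / e + 1.
have B0 : 0 < B.
  rewrite ltr_wpDl// divr_ge0 ?(ltW e0)// !mulr_ge0//; exact: ltW.
pose ka := k * (t / B).
have ka0 : 0 <= ka by rewrite mulr_ge0 ?divr_ge0 ?(ltW k0) ?(ltW t0) ?(ltW B0).
have kae : M `^ q * ka <= e / 2.
  rewrite /ka (_ : _ * _ = (M `^ q * k * t) / B); last by move: B^-1 => i; ring.
  rewrite ler_pdivrMr// /B mulrDr mulr1.
  rewrite (_ : e / 2 * _ = M `^ q * k * t); last by field; rewrite gt_eqF.
  by rewrite lerDl divr_ge0// ltW.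
(* So that |y| >= r implies |x - y|^2 >= r^2 / 2 - |x|^2 = 8 B. *)
pose r := Num.sqrt (2 * (8 * B + sqn x)).
have r20 : 0 < 2 * (8 * B + sqn x).
  by rewrite mulr_gt0// ltr_wpDr ?sqn_ge0// mulr_gt0.
have r0 : 0 < r by rewrite sqrtr_gt0.
have r2 : r ^+ 2 = 2 * (8 * B + sqn x) by rewrite sqr_sqrtr// ltW.
pose C := hcst t * (q * M `^ (q - 1)) + 1.
have C'0 : 0 <= hcst t * (q * M `^ (q - 1)).
  by rewrite !mulr_ge0 ?powR_ge0 ?(ltW q0)//; exact/ltW/heat_cst_gt0.
have C0 : 0 < C by rewrite ltr_wpDl.
pose E := eball 0 r `&` Omega.
have mO : measurable Omega by exact: measurable_open_rV.
have mE : measurable E by apply: measurableI => //; exact: measurable_eball.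
have eC : 0 < e / 2 / C by rewrite !divr_gt0.
have : \forall s \near (0 : R)^'+,
    (\int[mu]_(y in E) `|w s y - f y|%:E < (e / 2 / C)%:E)%E.
  have /fine_cvgP[fn /cvgr_lt/(_ _ eC)] := wf r r0.
  apply: filterS2 fn => s fs /= es.
  by rewrite -(fineK fs) lte_fin.
have : \forall s \near (0 : R)^'+, 0 < s by exact: nbhs_right_gt.
apply: filterS2 => s s0 Ie.
set h := (fun y => `|w s y| `^ q) \_ Omega.
have h0 y : 0 <= h y by rewrite /h patchE; case: ifP => // _; exact: powR_ge0.
have hM y : h y <= M `^ q.
  rewrite /h patchE; case: ifP => [|_]; last exact: powR_ge0.
  rewrite inE => Oy; have vy := wM _ _ s0 Oy.
  by apply: ge0_ler_powR; rewrite ?nnegrE ?(ltW q0)// (le_trans _ vy).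
have mh : measurable_fun setT h.
  by apply: measurable_powR_restrict => //; apply: measurableT_comp => //; exact: mw.
pose D := (fun y => `|w s y - f y|) \_ E.
have D0 y : 0 <= D y by rewrite /D patchE; case: ifP.
have mD : measurable_fun setT D.
  apply/(measurable_restrictT _ _).1 => //; apply: measurableT_comp => //.
  apply: measurable_funB; apply: (measurable_funS mO) => //; try exact: mw.
  - by move=> y [].
  - by move=> y [].
have hk y : heatk t x y * h y <=
    heatk t x y * g y + (C * D y + M `^ q * ka * heatk (2 * t) x y).
  have hk0 : 0 < heatk t x y := heatk_gt0 _ _ _.
  have hk20 : 0 < heatk (2 * t) x y := heatk_gt0 _ _ _.
  have p1 : 0 <= heatk t x y * g y by apply: mulr_ge0 => //; exact: ltW.
  have p2 : 0 <= C * D y by apply: mulr_ge0 => //; exact: ltW.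
  have p3 : 0 <= M `^ q * ka * heatk (2 * t) x y.
    by apply: mulr_ge0; [exact: mulr_ge0|exact: ltW].
  have [Oy|nOy] := pselect (Omega y); last first.
    by rewrite {1}/h patchE memNset// mulr0; do 2! (apply: addr_ge0 => //).
  have [yr|ry] := ltrP (sqn y) (r ^+ 2); last first.
    have tail : heatk t x y <= ka * heatk (2 * t) x y.
      have xy : 8 * B <= sqn (x - y).
        have := sqnD (y - x) x; rewrite subrK sqnBC; rewrite r2 in ry; lra.
      rewrite (le_trans (heatk_tail t0 xy))// ler_pM2r//.
      rewrite (_ : 8 * B / (8 * t) = B / t); last by field; rewrite gt_eqF.
      exact: expR_inv_le.
    apply: (@le_trans _ _ (M `^ q * ka * heatk (2 * t) x y)).
      rewrite mulrC -mulrA; apply: ler_pM => //; exact: ltW.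
    by rewrite addrA lerDr addr_ge0.
  have DE : D y = `|w s y - f y|.
    rewrite /D patchE mem_set//; split => //.
    by rewrite /eball/= subr0 enorm_lt.
  apply: (@le_trans _ _ (heatk t x y * g y + C * D y)); last first.
    by rewrite addrA lerDl.
  rewrite /h /g /power_data !patchE !mem_set// DE.
  have wy := wM _ _ s0 Oy.
  have [wm|mw'] := lerP `|w s y| (Num.min `|f y| M).
    apply: (@le_trans _ _ (heatk t x y * Num.min `|f y| M `^ q)).
      apply: ler_wpM2l; first exact: ltW.
      by apply: ge0_ler_powR; rewrite ?nnegrE ?(ltW q0)// (le_trans _ wm).
    by rewrite lerDl mulr_ge0// ltW.
  (* Since |w| <= M, exceeding the minimum of |f y| and M forces this minimum to be |f y|. *)
  have fE : Num.min `|f y| M = `|f y|.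
    apply/min_idPl; rewrite leNgt; apply/negP => Mf.
    by move: mw'; rewrite (min_idPr (ltW Mf)) ltNge wy.
  rewrite fE in mw' *.
  have := powR_sub_le q1 (normr_ge0 (f y)) (ltW mw').
  move=> /(ler_wpM2l (ltW hk0)) /le_trans; apply.
  rewrite mulrDr lerD2l.
  apply: (@le_trans _ _ (hcst t * (q * M `^ (q - 1)) * `|w s y - f y|)); last first.
    by rewrite ler_wpM2r// lerDl.
  rewrite [leLHS]mulrA; apply: ler_pM.
  - by apply: mulr_ge0; [exact: ltW|rewrite mulr_ge0 ?powR_ge0 ?(ltW q0)].
  - by rewrite subr_ge0 ltW.
  - apply: ler_pM => //; first exact: ltW.
    + by rewrite mulr_ge0 ?powR_ge0 ?(ltW q0).
    + rewrite /heatk -[leRHS]mulr1; apply: ler_wpM2l; first exact/ltW/heat_cst_gt0.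
      rewrite /gauss -expR0 ler_expR oppr_le0 divr_ge0 ?sqn_ge0// mulr_ge0//.
      exact: ltW.
    + apply: ler_wpM2l; first exact: ltW.
      by apply: ge0_ler_powR; rewrite ?nnegrE ?subr_ge0 ?(ltW q1)// (le_trans _ wy).
  - exact: lerB_dist.
have t20 : 0 < 2 * t by rewrite mulr_gt0.
have mk s' : measurable_fun setT (heatk s' x) by exact: measurable_heatk.
have mA : measurable_fun setT (fun y => (heatk t x y * g y)%:E).
  by apply/measurable_EFinP/measurable_funM.
have mB : measurable_fun setT (fun y => (C%:E * (D y)%:E)%E).
  by apply: emeasurable_funM => //; exact/measurable_EFinP.
have mC : measurable_fun setT
    (fun y => ((M `^ q * ka)%:E * (heatk (2 * t) x y)%:E)%E).
  by apply: emeasurable_funM => //; exact/measurable_EFinP.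
have mBC := emeasurable_funD mB mC.
have A0 y : (0 <= (heatk t x y * g y)%:E)%E.
  by rewrite lee_fin mulr_ge0// ltW// heatk_gt0.
have B'0 y : (0 <= C%:E * (D y)%:E)%E by rewrite -EFinM lee_fin mulr_ge0// ltW.
have C''0 y : (0 <= (M `^ q * ka)%:E * (heatk (2 * t) x y)%:E)%E.
  rewrite -EFinM lee_fin; apply: mulr_ge0; first exact: mulr_ge0.
  exact/ltW/heatk_gt0.
have hk0 y : (0 <= (heatk t x y * h y)%:E)%E.
  by rewrite lee_fin mulr_ge0// ltW// heatk_gt0.
have key : (\int[mu]_y (heatk t x y * h y)%:E <= (heatp g t x + e)%:E)%E.
  apply: (@le_trans _ _ (\int[mu]_y ((heatk t x y * g y)%:E +
      (C%:E * (D y)%:E + (M `^ q * ka)%:E * (heatk (2 * t) x y)%:E)))%E).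
    apply: ge0_le_integral => //.
    - by apply/measurable_EFinP/measurable_funM.
    - exact: emeasurable_funD.
    by move=> y _; rewrite -!EFinM -!EFinD lee_fin.
  rewrite ge0_integralD//; last by move=> y _; exact: adde_ge0.
  rewrite ge0_integralD//.
  have -> : (\int[mu]_y (heatk t x y * g y)%:E)%E = (heatp g t x)%:E.
    rewrite /heatp /Rintegral fineK//; apply: integrable_fin_num => //.
    exact: (integrable_heatk_mul mg g0 gM).
  rewrite [leRHS]EFinD; apply: leeD2l.
  rewrite [e in leRHS]splitr [leRHS]EFinD; apply: leeD.
    rewrite ge0_integralZl//; last 3 first.
    - exact/measurable_EFinP.
    - by move=> y _; rewrite lee_fin.
    - by rewrite lee_fin ltW.
    rewrite (_ : (\int[mu]_y (D y)%:E)%E = (\int[mu]_(y in E) `|w s y - f y|%:E)%E).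
      rewrite -(divfK (lt0r_neq0 C0) (e / 2)) mulrC EFinM.
      by apply: lee_wpmul2l; [rewrite lee_fin ltW|exact: ltW].
    rewrite [RHS]integral_mkcond; apply: eq_integral => y _.
    by rewrite /D !patchE; case: ifP.
  rewrite ge0_integralZl//; last 3 first.
  - exact/measurable_EFinP.
  - by move=> y _; rewrite lee_fin ltW// heatk_gt0.
  - by rewrite lee_fin mulr_ge0.
  by rewrite integral_heatk// mule1 lee_fin.
have fin : (\int[mu]_y (heatk t x y * h y)%:E)%E \is a fin_num.
  by rewrite ge0_fin_numE ?integral_ge0// (le_lt_trans key)// ltry.
by rewrite -lee_fin fineK.
Unshelve. all: by end_near. Qed.

(** Comparison from time s bounds w(s + t) through the potential of |w(s)|^q, and s tends to 0. As M
    is fixed before a and b, these may later depend on the point: the tangent at the value of the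
    potential there yields its power 1/q. *)
Lemma heat_flow_le Omega (f : 'rV[R]_n -> R) w (q : R) :
  open Omega -> measurable_fun Omega f -> 1 < q -> heat_flow Omega f w ->
  exists2 M, 0 <= M & forall a b, 0 <= a -> 0 <= b ->
    (forall y : R, 0 <= y -> y <= a * y `^ q + b) ->
    forall t x, 0 < t -> Omega x ->
    `|w t x| <= a * heatp (power_data Omega f q M) t x + b.
Proof.
move=> oO mf q1 [wD [M' wM'] wf]; pose M := `|M'|.
have wM t x : 0 < t -> Omega x -> `|w t x| <= M.
  by move=> t0 Ox; rewrite (le_trans (wM' _ _ t0 Ox))// ler_norm.
exists M; first exact: normr_ge0.
move=> a b a0 b0 ab t x t0 Ox.
have q0 : 0 < q by apply: lt_trans q1.
have cw := dirichlet_classical_data oO wD.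
have cy s y : 0 < s -> Omega y -> cylinder Omega +oo (s, y).
  by move=> s0 Oy; split => //=; exact: ltry.
have mw s : 0 < s -> measurable_fun Omega (w s).
  move=> s0; apply: measurable_fun_open_rV => // y Oy.
  by apply: classical_data_slice cw (cy _ _ s0 Oy).
have cwo : classical_data Omega +oo (fun _ _ => 0) (fun t x => - w t x).
  have := classical_data_opp cw.
  by rewrite (_ : (fun _ _ => - 0) = (fun _ _ => 0))// oppr0.
have wt s : 0 < s -> `|w (s + t) x| <=
    a * heatp ((fun y => `|w s y| `^ q) \_ Omega) t x + b.
  move=> s0; rewrite ler_norml lerNl; apply/andP; split; last first.
    exact: (linear_comparison oO q0 cw wM a0 b0 ab s0 t0 Ox).
  have := @linear_comparison R n Omega oO (fun t x => - w t x) M a b q s q0 cwo.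
  have E : (fun y => `|- w s y| `^ q) = (fun y => `|w s y| `^ q).
    by apply/funext => y; rewrite normrN.
  rewrite E; apply => //.
  by move=> r y r0 Oy; rewrite normrN; exact: wM.
apply/ler_addgt0Pl => e e0.
pose e1 := e / (2 * (a + 1)).
have a1 : 0 < a + 1 by rewrite ltr_wpDl.
have e10 : 0 < e1 by rewrite divr_gt0// mulr_gt0.
have e20 : 0 < e / 2 by rewrite divr_gt0.
have ae1 : a * e1 <= e / 2.
  rewrite /e1 invfM !mulrA ler_pdivrMr//.
  have : 0 <= a * e by rewrite mulr_ge0// ltW.
  lra.
have n1 := @heatp_near_initial Omega f w M q t e1 x oO mf mw q1 (normr_ge0 M') wM wf t0 e10.
have n2 : \forall s \near (0 : R)^'+, `|w (s + t) x| > `|w t x| - e / 2.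
  have ctx : cylinder (closure Omega) +oo (t, x).
    by split => //=; [exact: ltry|exact: subset_closure].
  have [[A B]/= [At Bx] AB] := classical_data_near cw ctx e20.
  have sh : s + t @[s --> (0 : R)] --> t.
    by rewrite -[X in _ --> X]add0r; apply: cvgD; [exact: cvg_id|exact: cvg_cst].
  have nA : \forall s \near (0 : R)^'+, A (s + t) by exact: cvg_at_right_filter sh _ At.
  have n0 : \forall s \near (0 : R)^'+, 0 < s by exact: nbhs_right_gt.
  apply: filterS2 nA n0 => s As s0.
  have cs : cylinder (closure Omega) +oo (s + t, x).
    by split => //=; [exact: addr_gt0|exact: ltry|exact: subset_closure].
  have /= := AB (s + t, x) (conj As (nbhs_singleton Bx)) cs.
  have := ler_dist_dist (w t x) (w (s + t) x); rewrite [`|w t x - _|]distrC.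
  by have := ler_norm (`|w t x| - `|w (s + t) x|); lra.
near (0 : R)^'+ => s.
have s0 : 0 < s by near: s; exact: nbhs_right_gt.
have h1 : heatp ((fun y => `|w s y| `^ q) \_ Omega) t x <=
    heatp (power_data Omega f q M) t x + e1 by near: s.
have h2 : `|w (s + t) x| > `|w t x| - e / 2 by near: s.
have fin (X Y U V : R) : U - e / 2 < V -> a * X <= a * (Y + e1) ->
    V <= a * X + b -> U <= e + (a * Y + b).
  by clear -ae1; rewrite mulrDr => *; lra.
exact: fin h2 (ler_wpM2l a0 h1) (wt s s0).
Unshelve. all: by end_near. Qed.

End heat_flow_bound.

(** * The supersolution and the nonlinear comparison *)

Section nonlinear_comparison.
Context {R : realType} {n : nat}.
Implicit Types (x y : 'rV[R]_n) (Omega : set 'rV[R]_n).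

Context (p q : R) (p1 : 1 < p) (q1 : 1 < q).

(** The bound 1 is for concavity; the bound p/q makes the source, of order phi^(p/q), equal to
    phi^sg times a nonnegative power, which decay controls. Both exceed 1/q, hence gam > 0. *)
Definition super_exp : R := Num.min 1 (p / q).

(** The exponent for which t^gam phi^sg scales like phi^(1/q) when phi is of order t^(-q/(p-1)). *)
Definition super_time_exp : R := (super_exp * q - 1) / (p - 1).

Local Notation sg := super_exp.
Local Notation gam := super_time_exp.

Let q0 : 0 < q. Proof. exact: lt_trans q1. Qed.
Let p0 : 0 < p. Proof. exact: lt_trans p1. Qed.
Let pm0 : 0 < p - 1. Proof. by rewrite subr_gt0. Qed.

Lemma super_exp_bounds : [/\ 0 < sg, sg <= 1, sg <= p / q & q^-1 <= sg].
Proof.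
rewrite /sg; split.
- by rewrite lt_min ltr01 divr_gt0.
- by rewrite ge_min lexx.
- by rewrite ge_min lexx orbT.
- by rewrite le_min invf_le1// (ltW q1) ler_peMl ?invr_ge0 ?(ltW p1) ?(ltW q0).
Qed.

Lemma super_time_exp_gt0 : 0 < gam.
Proof.
apply: divr_gt0 => //; rewrite subr_gt0 /sg minr_pMl ?ltW// mul1r divfK ?gt_eqF//.
by rewrite lt_min q1.
Qed.

(** Determined by B gam = 2^p N^(p/q - sg), the factor with which the derivative of B t^gam absorbs
    the source when phi <= N t^(-q/(p-1)). *)
Definition super_coef (N : R) : R := 2 `^ p * N `^ (p / q - sg) / gam.

Lemma super_coef_gt0 N : 0 < N -> 0 < super_coef N.
Proof.
by move=> N0; rewrite divr_gt0 ?super_time_exp_gt0// mulr_gt0 ?powR_gt0.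
Qed.

Lemma powR_decay (P N t k e : R) : 0 <= P -> 0 < N -> 0 < t -> 0 <= e ->
  P <= N * t `^ (- k) -> P `^ e <= N `^ e * t `^ (- (k * e)).
Proof.
move=> P0 N0 t0 e0 PN; apply: (@le_trans _ _ ((N * t `^ (- k)) `^ e)).
  by apply: ge0_ler_powR; rewrite ?nnegrE ?mulr_ge0 ?powR_ge0// ltW.
by rewrite powRM ?powR_ge0 ?(ltW N0)// -powRrM mulNr.
Qed.

Context (N : R) (N0 : 0 < N) (Nsmall : 2 `^ p * N `^ ((p - 1) / q) <= gam).
Context (P t : R) (P0 : 0 < P) (t0 : 0 < t) (PN : P <= N * t `^ (- (q / (p - 1)))).

(** Factoring out P^(1/q) leaves B t^gam P^(sg - 1/q); under the decay of P the powers of t cancel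
    and 2^p N^((p-1)/q) / gam remains, at most 1 by smallness. *)
Lemma super_correction_le : super_coef N * t `^ gam * P `^ sg <= P `^ q^-1.
Proof.
have [sg0 _ _ sgq] := super_exp_bounds.
have e0 : 0 <= sg - q^-1 by rewrite subr_ge0.
have -> : P `^ sg = P `^ q^-1 * P `^ (sg - q^-1).
  by rewrite -powRD ?(gt_eqF P0) ?implybT//; congr powR; ring.
rewrite mulrCA ler_piMr ?powR_ge0//.
have /(_ e0 PN) := @powR_decay P N t (q / (p - 1)) (sg - q^-1) (ltW P0) N0 t0.
have -> : q / (p - 1) * (sg - q^-1) = gam.
  by rewrite /gam; field; rewrite !gt_eqF.
move=> h; apply: (@le_trans _ _ (super_coef N * t `^ gam *
    (N `^ (sg - q^-1) * t `^ (- gam)))).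
  by rewrite ler_wpM2l// mulr_ge0 ?powR_ge0// ltW// super_coef_gt0.
rewrite mulrACA -powRD ?(gt_eqF t0) ?implybT// subrr powRr0 mulr1.
have -> : super_coef N * N `^ (sg - q^-1) = 2 `^ p * N `^ ((p - 1) / q) / gam.
  rewrite (_ : (p - 1) / q = (p / q - sg) + (sg - q^-1)); last first.
    by rewrite mulrBl mul1r; ring.
  rewrite [in RHS]powRD ?(gt_eqF N0) ?implybT// /super_coef.
  by move: gam^-1 => i; ring.
by rewrite ler_pdivrMr ?super_time_exp_gt0// mul1r.
Qed.

(** In P^(p/q) = P^sg P^(p/q - sg), the decay of the second factor produces exactly t^(gam - 1). *)
Lemma super_source_le :
  (2 * P `^ q^-1) `^ p <= super_coef N * gam * t `^ (gam - 1) * P `^ sg.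
Proof.
have [sg0 _ sgp sgq] := super_exp_bounds.
have e0 : 0 <= p / q - sg by rewrite subr_ge0.
rewrite powRM ?powR_ge0// -powRrM.
have -> : P `^ (q^-1 * p) = P `^ sg * P `^ (p / q - sg).
  by rewrite -powRD ?(gt_eqF P0) ?implybT//; congr powR; ring.
rewrite /super_coef divfK ?gt_eqF ?super_time_exp_gt0//.
have /(_ e0 PN) := @powR_decay P N t (q / (p - 1)) (p / q - sg) (ltW P0) N0 t0.
have -> : - (q / (p - 1) * (p / q - sg)) = gam - 1.
  by rewrite /gam; field; rewrite !gt_eqF.
move=> h; rewrite mulrCA mulrC; apply: ler_wpM2r; first exact: powR_ge0.
by rewrite -mulrA; apply: ler_wpM2l => //; exact: powR_ge0.
Qed.

End nonlinear_comparison.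

Section supersolution.
Context {R : realType} {n : nat}.
Implicit Types (x y : 'rV[R]_n) (Omega : set 'rV[R]_n).

Lemma powR_continuous (a r : R) : 0 < a -> {for a, continuous (@powR R ^~ r)}.
Proof.
move=> a0; apply: differentiable_continuous; apply/derivable1_diffP.
by have [] := is_derive1_powR r a0.
Qed.

Lemma power_nonlinearity_ge0 (p v : R) : 0 < v -> power_nonlinearity p v = v `^ p.
Proof.
move=> v0; rewrite /power_nonlinearity gtr0_norm//.
by rewrite -{2}[v]powRr1 ?(ltW v0)// -powRD ?(gt_eqF v0) ?implybT// subrK.
Qed.

Lemma power_nonlinearity_opp (p v : R) :
  power_nonlinearity p (- v) = - power_nonlinearity p v.
Proof. by rewrite /power_nonlinearity normrN mulrN. Qed.

(* The supersolution is [phi `^ (1/q) + super_coef N * t `^ gam * phi `^ sg] with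
   [phi = heatp g + eta]; the maximum principle is applied with tangent lines in
   place of the two concave powers, so that no chain rule is needed. *)
Lemma nonlinear_comparison Omega (p q N eta Mg M T' : R) (T : \bar R)
    (g : 'rV[R]_n -> R) (u : R -> 'rV[R]_n -> R) :
  open Omega -> 1 < p -> 1 < q -> 0 < N -> 0 < eta ->
  2 `^ p * N `^ ((p - 1) / q) <= super_time_exp p q ->
  measurable_fun setT g -> (forall y, 0 <= g y) -> (forall y, g y <= Mg) ->
  (T'%:E < T)%E ->
  classical_data Omega T (fun t x => power_nonlinearity p (u t x)) u ->
  (forall t x, 0 < t <= T' -> Omega x -> `|u t x| <= M) ->
  (forall t x, 0 < t <= T' -> Omega x ->
     heatp g t x + eta <= N * t `^ (- (q / (p - 1)))) ->
  (forall e : R, 0 < e -> \forall t \near (0 : R)^'+, forall x, Omega x ->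
     u t x <= (heatp g t x + eta) `^ q^-1 + e) ->
  forall t x, 0 < t <= T' -> Omega x ->
    u t x <= 2 * N `^ q^-1 * t `^ (- (p - 1)^-1).
Proof.
move=> oO p1 q1 N0 eta0 Ns mg g0 gM T'T cu uM phiN init.
have q0 : 0 < q by apply: lt_trans q1.
have p0 : 0 < p by apply: lt_trans p1.
have q'0 : 0 < q^-1 by rewrite invr_gt0.
pose sg := super_exp p q; pose gam := super_time_exp p q.
pose B := super_coef p q N.
have [sg0 sg1 sgp sgq] := super_exp_bounds p1 q1.
have gam0 : 0 < gam by exact: super_time_exp_gt0.
have B0 : 0 < B by exact: super_coef_gt0.
pose phi t x := heatp g t x + eta.
have phi0 t x : 0 < phi t x by rewrite ltr_wpDl//; exact: heatp_ge0.
pose w t x := phi t x `^ q^-1 + B * t `^ gam * phi t x `^ sg.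
have cor0 t x : 0 <= B * t `^ gam * phi t x `^ sg.
  by apply: mulr_ge0; [apply: mulr_ge0; [exact: ltW|]|]; exact: powR_ge0.
have w0 t x : 0 < w t x by apply: ltr_pwDl; [exact: powR_gt0|exact: cor0].
pose z t x := u t x - w t x.
have cyl s y : 0 < s <= T' -> closure Omega y -> cylinder (closure Omega) T (s, y).
  by move=> /andP[s0 sT] cy; split => //=; rewrite (le_lt_trans _ T'T)// lee_fin.
have zle : forall t x, 0 < t <= T' -> Omega x -> z t x <= 0.
  (* Where z > 0 one has 0 < w < u <= M, and convexity gives u^p - w^p <= p M^(p-1) (u - w): this is
     K. *)
  apply: (@maximum_principle R n Omega T' (p * M `^ (p - 1)) M z oO).
  - apply: within_continuousB.
      have [wu _ _] := cu; apply: continuous_subspaceW wu => -[s y] /= [sT cy].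
      exact: cyl.
    move=> v; apply: (@continuous_in_subspaceT _ _ _ (fun v : R * 'rV[R]_n => w v.1 v.2)).
    move=> -[s y]; rewrite inE /= => -[/andP[s0 _] _].
    have cphi : phi v.1 v.2 @[v --> (s, y)] --> phi s y.
      by apply: cvgD; [exact: (heatp_continuous mg g0 gM)|exact: cvg_cst].
    have c1 : (v : R * 'rV[R]_n).1 @[v --> (s, y)] --> s by exact: cvg_fst.
    have cpow r : phi v.1 v.2 `^ r @[v --> (s, y)] --> phi s y `^ r.
      have := @powR_continuous (phi s y) r (phi0 s y); exact: (cvg_comp (fun v => phi v.1 v.2)).
    have ct : (v : R * 'rV[R]_n).1 `^ gam @[v --> (s, y)] --> s `^ gam.
      have := @powR_continuous s gam s0; exact: (cvg_comp (fun v : R * 'rV[R]_n => v.1)).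
    apply: cvgD; first exact: cpow.
    by apply: cvgM; [exact: cvgMl_tmp|exact: cpow].
  - move=> s y sT Oy; rewrite lerBlDr (le_trans (ler_norm _))//.
    by rewrite (le_trans (uM _ _ sT Oy))// lerDl ltW.
  - move=> s y sT by_; have [_ _ bd] := cu; rewrite /z bd ?sub0r ?oppr_le0 ?ltW//.
    by case: (cyl s y sT (proj1 by_)).
  - move=> x0 _ e e0; have In := init _ e0.
    exists (setT, [set s | forall x, Omega x -> u s x <= phi s x `^ q^-1 + e]).
      by split => //; exact: filterT.
    move=> [x s] /= [_ us] Ox; rewrite /z /w; have := us _ Ox.
    by have := cor0 s x; lra.
  move=> t x tT Ox zp; have /andP[t0 tT'] := tT.
  have ctx : cylinder Omega T (t, x).
    by split => //=; rewrite (le_lt_trans _ T'T)// lee_fin.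
  have [_ eq _] := cu; have [d0 [D0 [ud uD dD]]] := eq _ _ ctx.
  pose P := phi t x; have P0 : 0 < P := phi0 t x.
  (* Tangents lie above the powers, so [zeta] lies below z and touches it at (t, x). Below, eta is
     moved into the constants because the derivatives are those of [heatp g]. *)
  pose a := q^-1 * P `^ (q^-1 - 1); pose b := (1 - q^-1) * P `^ q^-1.
  pose a' := sg * P `^ (sg - 1); pose b' := (1 - sg) * P `^ sg.
  have [d [D [zd zD dDE]]] := @derivatives_sub_heatp R n g Mg u t d0
    (power_nonlinearity p (u t x)) a (a * eta + b) B gam a' (a' * eta + b') D0 x
    mg g0 gM t0 ud uD dD.
  pose zeta s y := u s y - (a * heatp g s y + (a * eta + b) +
    B * s `^ gam * (a' * heatp g s y + (a' * eta + b'))).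
  have zetaE s y : zeta s y = u s y - ((a * phi s y + b) +
      B * s `^ gam * (a' * phi s y + b')).
    by rewrite /zeta /phi; ring.
  exists zeta, d, D.
  have q'1 : 0 < q^-1 <= 1 by rewrite q'0 invf_le1// ltW.
  have sg01 : 0 < sg <= 1 by rewrite sg0.
  have zt : zeta t x = z t x.
    by rewrite zetaE /z /w /a /a' /b /b' !powR_tangent_eq.
  split.
  - exact: zt.
  - move=> s y _ _; rewrite zetaE /z /w lerD2l lerN2 lerD//.
      exact: powR_tangent (ltW (phi0 s y)) P0 q'1.
    apply: ler_wpM2l; first by rewrite mulr_ge0 ?powR_ge0// ltW.
    exact: powR_tangent (ltW (phi0 s y)) P0 sg01.
  - exact: zd.
  - exact: zD.
  rewrite dDE (_ : a' * _ + _ = P `^ sg); last first.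
    rewrite -(powR_tangent_eq sg P0) addrA -mulrDr.
    by [].
  have uw : w t x < u t x by rewrite -subr_gt0.
  have u0 : 0 < u t x := lt_trans (w0 t x) uw.
  have uM' : u t x <= M by rewrite (le_trans (ler_norm _))// uM.
  rewrite power_nonlinearity_ge0// lerBlDr.
  apply: le_trans (powR_sub_le p1 (ltW (w0 t x)) (ltW uw)) _.
  rewrite addrC; apply: lerD.
    apply: ler_wpM2r; first by rewrite subr_ge0 ltW.
    apply: ler_wpM2l; first exact: ltW.
    by apply: ge0_ler_powR; rewrite ?nnegrE ?subr_ge0 ?(ltW p1) ?(ltW u0)// (le_trans _ uM') ?ltW.
  have PN := phiN _ _ tT Ox.
  (* It remains to see w <= 2 P^(1/q), which is where the smallness of N enters. *)
  apply: le_trans (super_source_le p1 q1 N0 P0 t0 PN).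
  apply: ge0_ler_powR; rewrite ?nnegrE ?(ltW p0) ?(ltW (w0 t x)) ?mulr_ge0 ?powR_ge0//.
  have := super_correction_le p1 q1 N0 Ns P0 t0 PN.
  by rewrite /w -/P -/B -/gam -/sg; lra.
move=> t x tT Ox; have /andP[t0 _] := tT.
have := zle t x tT Ox; rewrite subr_le0 => /le_trans; apply.
have PN := phiN _ _ tT Ox.
have := super_correction_le p1 q1 N0 Ns (phi0 t x) t0 PN.
have := powR_decay (ltW (phi0 t x)) N0 t0 (ltW q'0) PN.
have -> : q / (p - 1) * q^-1 = (p - 1)^-1 by rewrite mulrAC mulfV ?mul1r// gt_eqF.
by rewrite /w -/B -/gam -/sg -/(phi t x); lra.
Qed.

End supersolution.

(** * Decay of small solutions *)

Section norms.
Context {R : realType} {n : nat}.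
Implicit Types (x y : 'rV[R]_n) (Omega : set 'rV[R]_n) (f : 'rV[R]_n -> R).
Local Notation mu := (@lebesgue_rV R n).

Lemma Linfty_norm_le Omega f (c : R) : 0 <= c ->
  (forall x, Omega x -> `|f x| <= c) -> (Linfty_norm Omega f <= c%:E)%E.
Proof.
move=> c0 fc; rewrite /Linfty_norm unlock; case: ifPn => _; last by rewrite lee_fin.
apply/ess_supP; apply: aeW => x /=; rewrite patchE.
case: ifPn => [|_]; last by rewrite abse0 lee_fin.
by rewrite inE => Ox; rewrite lee_fin fc.
Qed.

(** The part of Omega where |f| > c is open and null, hence empty. *)
Lemma le_Linfty_norm Omega f (c : R) : open Omega ->
  (forall x, Omega x -> {for x, continuous f}) ->
  (Linfty_norm Omega f <= c%:E)%E -> forall x, Omega x -> `|f x| <= c.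
Proof.
move=> oO cf; rewrite /Linfty_norm unlock => fc x Ox.
have muT : (0 < mu setT)%E by apply: lebesgue_open_gt0; [exact: openT|exists x].
rewrite muT in fc; move/ess_supP : fc => fc; rewrite leNgt; apply/negP => xc.
pose U := Omega `&` [set y | c < `|f y|].
have oU : open U.
  rewrite openE => y [Oy /= yc]; apply: filterI; first exact: open_nbhs_nbhs.
  have cy : {for y, continuous (fun y => `|f y|)}.
    by apply: (@continuous_comp _ _ _ f Num.norm); [exact: cf|exact: norm_continuous].
  exact: (@cvgr_gt _ _ (nbhs y) _ _ _ cy).
have U0 : mu U = 0.
  apply: measure_negligible; first exact: measurable_open_rV.
  apply: negligibleS fc => y [Oy /= yc] /=.
  rewrite patchE mem_set// lee_fin => fy.
  by have := lt_le_trans yc fy; rewrite ltxx.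
have := @lebesgue_open_gt0 R n U oU.
by rewrite U0 ltxx => /(_ _)/wrap[|//]; exists x.
Qed.

(** The supremum is nonnegative because Omega is nonempty, and finite because its power 1/q is;
    [fine] then loses nothing. *)
Lemma morrey_norm_ball Omega (q l : R) f : Omega !=set0 -> 0 < q ->
  (morrey_norm Omega q l f < +oo)%E ->
  [/\ 0 <= fine (morrey_norm Omega q l f),
      morrey_norm Omega q l f = (fine (morrey_norm Omega q l f))%:E &
      forall a (r : R), Omega a -> 0 < r ->
      (\int[mu]_(x in eball a r `&` Omega) (`|f x| `^ q)%:E <=
        (fine (morrey_norm Omega q l f) `^ q * r `^ (n%:R - l))%:E)%E].
Proof.
move=> [a0 Oa0] q0; rewrite /morrey_norm; set S := ereal_sup _ => Sy.
have Sub a r : Omega a -> 0 < r ->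
    ((r `^ (l - n%:R))%:E * \int[mu]_(x in eball a r `&` Omega) (`|f x| `^ q)%:E <= S)%E.
  by move=> Oa r0; apply: ereal_sup_ubound; exists a, r.
have I0 a r : (0 <= \int[mu]_(x in eball a r `&` Omega) (`|f x| `^ q)%:E)%E.
  by apply: integral_ge0 => x _; rewrite lee_fin powR_ge0.
have S0 : (0 <= S)%E.
  apply: le_trans (Sub a0 1 Oa0 ltr01).
  by apply: mule_ge0 => //; rewrite lee_fin powR_ge0.
have qi0 : q^-1 != 0 by rewrite invr_eq0 gt_eqF.
have Sfin : S \is a fin_num by rewrite ge0_fin_numE// (lty_poweRy qi0).
move: S0 Sub; rewrite -(fineK Sfin); move: (fine S) => s s0 Sub {Sy Sfin S}.
rewrite poweR_EFin /=; split => //; first exact: powR_ge0.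
move=> a r Oa r0; rewrite -powRrM mulVf ?gt_eqF// powRr1//.
have rp : 0 < r `^ (n%:R - l) by exact: powR_gt0.
have := lee_wpmul2l _ (Sub a r Oa r0).
move=> /(_ (r `^ (n%:R - l))%:E); rewrite lee_fin => /(_ (ltW rp)).
rewrite muleA -!EFinM -powRD ?(gt_eqF r0) ?implybT// [X in r `^ X](_ : _ = 0).
  by rewrite powRr0 mul1e mulrC.
by ring.
Qed.

End norms.

Section solutions.
Context {R : realType} {n : nat}.
Implicit Types (x y : 'rV[R]_n) (Omega : set 'rV[R]_n).
Local Notation mu := (@lebesgue_rV R n).

(* If no heat flow exists, [heat_semigroup] is the junk value [0]. *)
Lemma heat_semigroup_le Omega (f : 'rV[R]_n -> R) (q : R) :
  open Omega -> measurable_fun Omega f -> 1 < q ->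
  (forall t x, 0 < t -> Omega x -> {for x, continuous (heat_semigroup Omega t f)}) /\
  exists2 M, 0 <= M & forall a b, 0 <= a -> 0 <= b ->
    (forall y : R, 0 <= y -> y <= a * y `^ q + b) ->
    forall t x, 0 < t -> Omega x ->
    `|heat_semigroup Omega t f x| <= a * heatp (power_data Omega f q M) t x + b.
Proof.
move=> oO mf q1; rewrite /heat_semigroup.
have [ex|nex] := pselect (exists w, heat_flow Omega f w).
  have hf := xgetPex (fun _ _ => 0) ex; split; last exact: heat_flow_le hf.
  move=> t x t0 Ox; have [wD _ _] := hf.
  apply: classical_data_slice (dirichlet_classical_data oO wD) _ => //.
  by split => //=; exact: ltry.
rewrite xgetPN; last by move=> w hw; apply: nex; exists w.
split; first by move=> t x _ _; exact: (@cst_continuous _ _ (0 : R) x).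
exists 0 => // a b a0 b0 _ t x _ _; rewrite normr0 addr_ge0// mulr_ge0//.
by apply: heatp_ge0 => y; exact: power_data_ge0.
Qed.

(** Solution and semigroup are continuous on Omega, so the essential bounds hold at every point,
    uniformly in x. *)
Lemma classical_solution_initial Omega (p q : R) (f : 'rV[R]_n -> R)
    (T : \bar R) u : open Omega -> measurable_fun Omega f -> 1 < q ->
  classical_solution Omega p f T u ->
  forall e : R, 0 < e -> \forall t \near (0 : R)^'+, forall x, Omega x ->
    `|u t x - heat_semigroup Omega t f x| <= e.
Proof.
move=> oO mf q1 [T0 uD _ ini] e e0.
have cu := dirichlet_classical_data oO uD.
have [cH _] := heat_semigroup_le oO mf q1.
have n1 : \forall t \near (0 : R)^'+, (Linfty_norm Omega
    (fun x => u t x - heat_semigroup Omega t f x)%R < e%:E)%E.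
  have /fine_cvgP[fn /cvgr_lt/(_ _ e0)] := ini.
  by apply: filterS2 fn => t /= ft et; rewrite -(fineK ft) lte_fin.
have n2 : \forall t \near (0 : R)^'+, (t%:E < T)%E.
  case: T T0 {uD cu} => [T|_|//]; last by near=> t; exact: ltry.
  rewrite lte_fin => T0; near=> t; rewrite lte_fin; near: t.
  exact: nbhs_right_lt.
have n0 : \forall t \near (0 : R)^'+, 0 < t by exact: nbhs_right_gt.
near=> t.
have t0 : 0 < t by near: t.
have tT : (t%:E < T)%E by near: t.
apply: le_Linfty_norm => //.
  move=> x Ox; apply: (@cvgB _ _ _ (nbhs x)); last exact: cH.
  exact: classical_data_slice cu _.
by apply/ltW; near: t.
Unshelve. all: by end_near. Qed.

Lemma integral_power_data_le Omega (f : 'rV[R]_n -> R) (q M r : R) a :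
  open Omega -> measurable_fun Omega f -> 0 <= q -> 0 <= M ->
  (\int[mu]_(x in eball a r) (power_data Omega f q M x)%:E <=
   \int[mu]_(x in eball a r `&` Omega) (`|f x| `^ q)%:E)%E.
Proof.
move=> oO mf q0 M0.
rewrite [leLHS]integral_mkcond [leRHS]integral_mkcond.
have mO : measurable Omega by exact: measurable_open_rV.
have mB : measurable (eball a r) by exact: measurable_eball.
apply: ge0_le_integral => //.
- move=> x _; rewrite patchE; case: ifP => // _; rewrite lee_fin.
  exact: power_data_ge0.
- apply/(measurable_restrictT _ _).1 => //; apply/measurable_EFinP.
  by apply: measurable_funS (measurable_power_data q M oO mf).
- apply/(measurable_restrictT _ _).1; first exact: measurableI.
  apply/measurable_EFinP.
  apply: (@measurableT_comp _ _ _ _ _ _ (@powR R ^~ q)); first exact: measurable_powR.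
  apply: measurableT_comp => //; apply: (measurable_funS mO) => //.
move=> x _; rewrite !patchE /power_data patchE in_setI.
case: (x \in eball a r) => //=; case: (x \in Omega) => //.
rewrite lee_fin; apply: ge0_ler_powR; rewrite ?nnegrE ?le_min ?normr_ge0//.
by rewrite ge_min lexx.
Qed.

End solutions.

Section decay.
Context {R : realType} {n : nat}.
Implicit Types (x y : 'rV[R]_n) (Omega : set 'rV[R]_n).
Local Notation mu := (@lebesgue_rV R n).

Definition decay_cst : R := 2 * (@heat_cst R n 1 * @shell_cst R n).

Lemma decay_cst_gt0 : 0 < decay_cst.
Proof.
rewrite mulr_gt0// mulr_gt0//; [exact: heat_cst_gt0|exact: shell_cst_gt0].
Qed.

(** The nonlinear comparison is applied on (0, t] to u and to -u, with N = K m^q + del, K being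
    [decay_cst]: the first term comes from the Morrey bound and del pays for eta. *)
Lemma solution_decay Omega (p q m del : R) (u0 : 'rV[R]_n -> R) (T : \bar R) u :
  open Omega -> measurable_fun Omega u0 -> 1 < p -> 1 < q ->
  2 * q / (p - 1) <= n%:R -> 0 <= m -> 0 < del ->
  (forall a (r : R), Omega a -> 0 < r ->
    (\int[mu]_(x in eball a r `&` Omega) (`|u0 x| `^ q)%:E <=
     (m `^ q * r `^ (n%:R - 2 * q / (p - 1)))%:E)%E) ->
  2 `^ p * (decay_cst * m `^ q + del) `^ ((p - 1) / q) <= super_time_exp p q ->
  classical_solution Omega p u0 T u ->
  forall t x, 0 < t -> (t%:E < T)%E -> Omega x ->
  `|u t x| <= 2 * (decay_cst * m `^ q + del) `^ q^-1 * t `^ (- (p - 1)^-1).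
Proof.
move=> oO mu0 p1 q1 ln m0 del0 morr small cs t x t0 tT Ox.
have q0 : 0 < q by apply: lt_trans q1.
have pm0 : 0 < p - 1 by rewrite subr_gt0.
have kap0 : 0 < q / (p - 1) by rewrite divr_gt0.
have mq0 : 0 <= m `^ q by exact: powR_ge0.
set N := decay_cst * m `^ q + del in small *.
have N0 : 0 < N by rewrite ltr_wpDl// mulr_ge0// ltW// decay_cst_gt0.
have [_ [M M0 HM]] := heat_semigroup_le oO mu0 q1.
have ini := classical_solution_initial oO mu0 q1 cs.
have [T0 uD ub _] := cs.
have cu := dirichlet_classical_data oO uD.
set g := power_data Omega u0 q M in HM.
have mg : measurable_fun setT g by exact: measurable_power_data.
have g0 y : 0 <= g y by exact: power_data_ge0.
have gM y : g y <= M `^ q by apply: power_data_le => //; exact: ltW.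
(* Since t ends the comparison interval, eta <= del s^(-q/(p-1)) for every s <= t. *)
pose eta := del * t `^ (- (q / (p - 1))).
have eta0 : 0 < eta by rewrite mulr_gt0// powR_gt0.
have [B uB] := ub t tT.
have phiN s y : 0 < s <= t -> Omega y ->
    heatp g s y + eta <= N * s `^ (- (q / (p - 1))).
  move=> /andP[s0 st] Oy; rewrite /N mulrDl lerD//.
    have l0 : 0 <= 2 * q / (p - 1) <= n%:R by rewrite ln andbT divr_ge0 ?mulr_ge0 ?ltW.
    have gb r : 0 < r -> (\int[mu]_(z in eball y r) (g z)%:E <=
        (m `^ q * r `^ (n%:R - 2 * q / (p - 1)))%:E)%E.
      move=> r0; apply: le_trans (morr y r Oy r0).
      by apply: integral_power_data_le => //; exact: ltW.
    have := heatp_morrey mg g0 l0 s0 mq0 gb.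
    by rewrite (_ : 2 * q / (p - 1) / 2 = q / (p - 1)) //; field; rewrite gt_eqF.
  rewrite /eta ler_pM2l// !powRN lef_pV2 ?posrE ?powR_gt0//.
  by apply: ge0_ler_powR; rewrite ?nnegrE ?(ltW kap0) ?(ltW s0) ?(ltW t0).
have near_init e : 0 < e -> \forall s \near (0 : R)^'+, forall y, Omega y ->
    `|u s y| <= (heatp g s y + eta) `^ q^-1 + e.
  move=> e0; have n0 : \forall s \near (0 : R)^'+, 0 < s by exact: nbhs_right_gt.
  apply: filterS2 n0 (ini e e0) => s s0 us y Oy.
  set P := heatp g s y + eta.
  have P0 : 0 < P by rewrite ltr_wpDl//; exact: heatp_ge0.
  have q'1 : 0 < q^-1 <= 1 by rewrite invr_gt0 q0 invf_le1// ltW.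
  (* The tangent at P depends on (s, y), which [HM] permits; it turns the affine bound into
     P^(1/q). *)
  pose a := q^-1 * P `^ (q^-1 - 1); pose b := (1 - q^-1) * P `^ q^-1.
  have a0 : 0 <= a by rewrite mulr_ge0 ?powR_ge0// invr_ge0 ltW.
  have b0 : 0 <= b by rewrite mulr_ge0 ?powR_ge0// subr_ge0; case/andP: q'1.
  have ab z : 0 <= z -> z <= a * z `^ q + b.
    move=> z0; have := powR_tangent (powR_ge0 z q) P0 q'1.
    by rewrite -powRrM mulfV ?gt_eqF// powRr1.
  have Hs := HM a b a0 b0 ab s y s0 Oy.
  have HP : `|heat_semigroup Omega s u0 y| <= P `^ q^-1.
    apply: le_trans Hs _; rewrite -(powR_tangent_eq q^-1 P0) -/a -/b lerD2r.
    by rewrite ler_wpM2l// lerDl ltW.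
  have := ler_normD (u s y - heat_semigroup Omega s u0 y) (heat_semigroup Omega s u0 y).
  by rewrite subrK; have := us y Oy; lra.
have tt : 0 < t <= t by rewrite t0 lexx.
rewrite ler_norml lerNl; apply/andP; split.
  have cuo : classical_data Omega T (fun t x => power_nonlinearity p (- u t x))
      (fun t x => - u t x).
    have := classical_data_opp cu.
    rewrite (_ : (fun t x => - power_nonlinearity p (u t x)) =
      (fun t x => power_nonlinearity p (- u t x)))//.
    by apply/funext => s; apply/funext => y; rewrite power_nonlinearity_opp.
  apply: (nonlinear_comparison oO p1 q1 N0 eta0 small mg g0 gM tT cuo (M := B) _ phiN _ tt Ox).
    by move=> s y st Oy; rewrite normrN; exact: uB.
  move=> e e0; apply: filterS (near_init e e0) => s us y Oy.
  by apply: le_trans (us y Oy); rewrite -normrN ler_norm.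
apply: (nonlinear_comparison oO p1 q1 N0 eta0 small mg g0 gM tT cu (M := B) _ phiN _ tt Ox).
  by move=> s y st Oy; exact: uB.
move=> e e0; apply: filterS (near_init e e0) => s us y Oy.
by apply: le_trans (us y Oy); rewrite ler_norm.
Qed.

End decay.

Theorem proposition6p1 (R : realType) (n : nat) (p q : R) :
  (0 < n)%N -> 1 < q -> 1 + 2 * q / n%:R <= p ->
  exists eps0 C0 : R,
    [/\ 0 < eps0, 0 < C0 &
      forall (alpha : R) (Omega : set 'rV[R]_n) (u0 : 'rV[R]_n -> R),
        0 < alpha < 1 -> C2alpha_domain alpha Omega ->
        Linfty Omega u0 -> morrey Omega q (2 * q / (p - 1)) u0 ->
        (morrey_norm Omega q (2 * q / (p - 1)) u0 <= eps0%:E)%E ->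
        forall (T : \bar R) (u : R -> 'rV[R]_n -> R),
          maximal_classical_solution Omega p u0 T u ->
          T = +oo%E /\
          (ereal_sup [set ((t `^ (1 / (p - 1)))%:E * Linfty_norm Omega (u t))%E
                     | t in [set t : R | (0 < t)%R]]
             <= C0%:E * morrey_norm Omega q (2 * q / (p - 1)) u0)%E].
Proof.
move=> n0 q1 hp.
have n0' : 0 < n%:R :> R by rewrite ltr0n.
have q0 : 0 < q by apply: lt_trans q1.
have p1 : 1 < p by apply: lt_le_trans hp; rewrite ltrDl divr_gt0// mulr_gt0.
have p0 : 0 < p by apply: lt_trans p1.
have pm0 : 0 < p - 1 by rewrite subr_gt0.
(* The hypothesis on p says that the Morrey exponent is at most n, the range in which the shell
   estimate applies. *)
have ln : 2 * q / (p - 1) <= n%:R.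
  by rewrite ler_pdivrMr// -ler_pdivrMl// (mulrC n%:R^-1) lerBrDl.
pose K := @decay_cst R n; have K0 : 0 < K := decay_cst_gt0.
pose gam := super_time_exp p q; have gam0 : 0 < gam by exact: super_time_exp_gt0.
(* The largest N with 2^p N^((p-1)/q) <= gam. *)
pose kap := (gam / 2 `^ p) `^ (q / (p - 1)).
have g2 : 0 < gam / 2 `^ p by rewrite divr_gt0// powR_gt0.
have kap0 : 0 < kap by exact: powR_gt0.
have small N : 0 <= N -> N <= kap -> 2 `^ p * N `^ ((p - 1) / q) <= gam.
  move=> N0 Nk; have p2 : 0 < 2 `^ p :> R by exact: powR_gt0.
  rewrite mulrC -ler_pdivlMr//.
  apply: (@le_trans _ _ (kap `^ ((p - 1) / q))).
    by apply: ge0_ler_powR; rewrite ?nnegrE ?divr_ge0 ?(ltW pm0) ?(ltW q0) ?(ltW kap0).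
  rewrite /kap -powRrM (_ : q / (p - 1) * ((p - 1) / q) = 1) ?powRr1 ?(ltW g2)//.
  by field; rewrite !gt_eqF.
(* Gives K m^q <= kap / 2 and leaves the other half of [kap] to del. *)
pose eps0 := (kap / (2 * K)) `^ q^-1.
have kK0 : 0 < kap / (2 * K) by rewrite divr_gt0// mulr_gt0.
exists eps0, (2 * K `^ q^-1); split; first exact: powR_gt0.
  by rewrite mulr_gt0// powR_gt0.
move=> alpha Omega u0 _ [oO _ On0 _] [mu0 _] [_ mfin] meps T u [cs _ _ blowup].
have [m0 mE mball] := morrey_norm_ball On0 q0 mfin.
move: meps; rewrite mE; move: (fine _) m0 mball => m m0 mball; rewrite lee_fin => meps.
have mq0 : 0 <= m `^ q by exact: powR_ge0.
have Kmq : K * m `^ q <= kap / 2.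
  have : m `^ q <= eps0 `^ q.
    by apply: ge0_ler_powR; rewrite ?nnegrE ?powR_ge0 ?(ltW q0).
  rewrite /eps0 -powRrM mulVf ?gt_eqF// powRr1 ?(ltW kK0)//.
  by rewrite invfM mulrA ler_pdivlMr// (mulrC _ K).
have Kmq0 : 0 <= K * m `^ q by apply: mulr_ge0 => //; exact: ltW.
have bound del t x : 0 < del -> del <= kap / 2 -> 0 < t -> (t%:E < T)%E -> Omega x ->
    `|u t x| <= 2 * (K * m `^ q + del) `^ q^-1 * t `^ (- (p - 1)^-1).
  move=> del0 delk t0 tT Ox.
  apply: (solution_decay oO mu0 p1 q1 ln m0 del0 mball _ cs t0 tT Ox).
  apply: small; first by apply: addr_ge0 => //; exact: ltW.
  by rewrite [leRHS]splitr lerD.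
have k20 : 0 < kap / 2 by rewrite divr_gt0.
have decay t x : 0 < t -> (t%:E < T)%E -> Omega x ->
    t `^ (1 / (p - 1)) * `|u t x| <= 2 * K `^ q^-1 * m.
  move=> t0 tT Ox; set Y := _ * _.
  have tp : 0 < t `^ (1 / (p - 1)) by exact: powR_gt0.
  have Y0 : 0 <= Y by rewrite mulr_ge0// ltW.
  have Yb del : 0 < del -> del <= kap / 2 -> Y <= 2 * (K * m `^ q + del) `^ q^-1.
    move=> del0 delk; have := bound del t x del0 delk t0 tT Ox.
    by rewrite powRN -ler_pdivrMr ?invr_gt0 ?powR_gt0// invrK mulrC /Y div1r.
  (* The limit del -> 0 is taken on q-th powers, where del enters additively. *)
  have Yq : (Y / 2) `^ q <= K * m `^ q.
    apply/ler_addgt0Pr => e e0; pose del := Num.min e (kap / 2).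
    have del0 : 0 < del by rewrite lt_min e0.
    have dele : del <= e by rewrite ge_min lexx.
    have := Yb del del0; rewrite ge_min lexx orbT => /(_ erefl).
    rewrite mulrC -ler_pdivrMr// => h.
    apply: (@le_trans _ _ (K * m `^ q + del)); last by rewrite lerD2l.
    have Kd : 0 <= K * m `^ q + del by apply: addr_ge0 => //; exact: ltW.
    have -> : K * m `^ q + del = ((K * m `^ q + del) `^ q^-1) `^ q.
      by rewrite -powRrM mulVf ?gt_eqF// powRr1.
    by apply: ge0_ler_powR; rewrite ?nnegrE ?powR_ge0 ?(ltW q0)// divr_ge0.
  have : ((Y / 2) `^ q) `^ q^-1 <= (K * m `^ q) `^ q^-1.
    by apply: ge0_ler_powR; rewrite ?nnegrE ?powR_ge0 ?invr_ge0 ?(ltW q0).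
  rewrite [leRHS]powRM ?(ltW K0)// -!powRrM !mulfV ?gt_eqF// !powRr1 ?divr_ge0//.
  by rewrite ler_pdivrMr// => /le_trans; apply; rewrite mulrC mulrA.
have [T0 _ _ _] := cs.
have TE : T = +oo%E.
  case: T T0 cs blowup bound decay => [T0|_|//] //.
  rewrite lte_fin => T00 _ blowup bound _; exfalso.
  (* With del = kap / 2 fixed, this bounds u for all t in (T0 / 2, T0), against the blow-up
     alternative. *)
  pose c := 2 * (K * m `^ q + kap / 2) `^ q^-1 * (T0 / 2) `^ (- (p - 1)^-1).
  have c0 : 0 <= c by rewrite !mulr_ge0 ?powR_ge0.
  have /cvgey_ge/(_ (c + 1)) := blowup T0 erefl.
  have T20 : T0 / 2 < T0 by rewrite ltr_pdivrMr// mulr_natr mulr2n ltrDl.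
  have n1 : \forall t \near T0^'-, T0 / 2 < t by exact: nbhs_left_gt.
  have n2 : \forall t \near T0^'-, t < T0 by exact: nbhs_left_lt.
  move=> n3; near T0^'- => t.
  have t1 : T0 / 2 < t by near: t.
  have t2 : t < T0 by near: t.
  have t0 : 0 < t by rewrite (lt_trans _ t1)// divr_gt0.
  have : ((c + 1)%:E <= Linfty_norm Omega (u t))%E by near: t.
  rewrite leNgt => /negP; apply; apply: (@le_lt_trans _ _ c%:E); last by rewrite lte_fin ltrDl.
  apply: Linfty_norm_le => // x Ox.
  apply: le_trans (bound _ t x k20 (lexx _) t0 _ Ox) _; first by rewrite lte_fin.
  apply: ler_wpM2l; first by rewrite mulr_ge0 ?powR_ge0.
  rewrite !powRN lef_pV2 ?posrE ?powR_gt0 ?divr_gt0//.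
  by apply: ge0_ler_powR; rewrite ?nnegrE ?invr_ge0 ?(ltW pm0) ?(ltW t0)
    ?divr_ge0 ?(ltW T00) ?(ltW t1).
split => //; apply: ge_ereal_sup => _ [t /= t0 <-].
have tp : 0 < t `^ (1 / (p - 1)) by exact: powR_gt0.
have C0 : 0 <= 2 * K `^ q^-1 * m by rewrite !mulr_ge0 ?powR_ge0.
pose Z := 2 * K `^ q^-1 * m / t `^ (1 / (p - 1)).
rewrite -EFinM (_ : 2 * K `^ q^-1 * m = t `^ (1 / (p - 1)) * Z); last first.
  by rewrite [RHS]mulrC /Z divfK ?gt_eqF.
rewrite [leRHS]EFinM; apply: lee_wpmul2l; first by rewrite lee_fin ltW.
apply: Linfty_norm_le => [|x Ox]; first by rewrite divr_ge0// ltW.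
rewrite ler_pdivlMr// mulrC; apply: decay => //.
by rewrite TE ltry.
Unshelve. all: by end_near. Qed.
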